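(* Let $\epsilon>0$ be a fixed constant. There is a polynomial-time algorithm which, given an instance $\langle I,\mathit{OPT},I'\rangle$ of Steiner tree reoptimization in which $I=\langle G,c,R\rangle$ is an $\mathit{STP}$ instance, $\mathit{OPT}$ is an optimal Steiner tree of $I$, and $I'=\langle G,c,R\setminus\{t\}\rangle$ for some terminal $t\in R$ (i.e., a single vertex changes its status from terminal to Steiner), computes a $(1+\epsilon)$-approximate Steiner tree of $I'$.
   Context: An instance of the Steiner tree problem ($\mathit{STP}$) is a triple $I=\langle G,c,R\rangle$ where $G$ is a connected undirected graph with $n$ vertices, $c:E(G)\to\mathbb{R}_{\ge 0}$ is an edge-cost function, and $R\subseteq V(G)$ is the set of terminals; vertices in $V(G)\setminus R$ are Steiner vertices. A Steiner tree of $I$ is a subtree of $G$ spanning $R$; its cost is the sum of its edge costs, and an optimal solution is a minimum-cost Steiner tree. A Steiner tree $S$ of $I'$ is $(1+\epsilon)$-approximate if $c(S)\le(1+\epsilon)\, c(\mathit{OPT}')$ for an optimal Steiner tree $\mathit{OPT}'$ of $I'$. ''Polynomial time'' refers to the input size, for fixed $\epsilon$. *)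

(* Defs.v *)
From HB Require Import structures.
From mathcomp Require Import all_boot all_order all_algebra.
From mathcomp Require Import reals.

Set Implicit Arguments.
Unset Strict Implicit.
Unset Printing Implicit Defensive.

Import Order.TTheory GRing.Theory Num.Theory.
Local Open Scope ring_scope.

(* Graphs live on the vertex set 'I_n; an edge is the 2-element set of its
   endpoints. *)
Section Graphs.
Variable n : nat.
Implicit Types (V : {set 'I_n}) (E : {set {set 'I_n}}).

Definition simple_graph E : Prop := forall e, e \in E -> #|e| = 2%N.

Definition adj E : rel 'I_n := fun x y => [set x; y] \in E.

Definition connected_on V E : Prop :=
  forall x y, x \in V -> y \in V -> connect (adj E) x y.

Definition acyclic E : Prop :=
  forall p : seq 'I_n, (2 < size p)%N -> ~ ucycle (adj E) p.

Record subgraph := Subgraph {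
  sverts : {set 'I_n};
  sedges : {set {set 'I_n}}
}.

Definition subtree E (S : subgraph) : Prop :=
  [/\ sverts S != set0,
      sedges S \subset E,
      (forall e, e \in sedges S -> e \subset sverts S),
      connected_on (sverts S) (sedges S)
    & acyclic (sedges S)].

End Graphs.

Section SteinerTree.
Variables (R : realType) (n : nat).

(* The values of [stp_cost] outside [stp_edges] are irrelevant. *)
Record stp := STP {
  stp_edges : {set {set 'I_n}};
  stp_cost : {set 'I_n} -> R;
  stp_terminals : {set 'I_n}
}.

Definition stp_instance (I : stp) : Prop :=
  [/\ simple_graph (stp_edges I),
      connected_on [set: 'I_n] (stp_edges I)
    & forall e, e \in stp_edges I -> 0 <= stp_cost I e].

Definition steiner_tree (I : stp) (S : subgraph n) : Prop :=
  subtree (stp_edges I) S /\ stp_terminals I \subset sverts S.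

Definition tree_cost (I : stp) (S : subgraph n) : R :=
  \sum_(e in sedges S) stp_cost I e.

Definition optimal (I : stp) (S : subgraph n) : Prop :=
  steiner_tree I S /\
  forall S', steiner_tree I S' -> tree_cost I S <= tree_cost I S'.

Definition approximate (eps : R) (I : stp) (S : subgraph n) : Prop :=
  steiner_tree I S /\
  exists OPT, optimal I OPT /\ tree_cost I S <= (1 + eps) * tree_cost I OPT.

End SteinerTree.

(* Model of computation: a first-order call-by-value Lisp over binary trees
   whose leaves are nil or a real number.  A program is a finite list of
   one-argument, mutually recursive functions, function 0 being the main one.
   Every elementary operation takes one time unit.

   This is a realistic cost measure.  Trees are immutable, hence represented
   by pointers, and each operation allocates O(1) memory cells; without real
   leaves the model is polynomially equivalent to Turing machines.  Real
   numbers are handled as in the real RAM: each occupies one cell, and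
   arithmetic has unit cost.  The only real operations are 0, +, - and <=:
   neither arbitrary real constants (which could encode advice) nor
   multiplication (which could square numbers repeatedly) are available.  In
   particular, on rational inputs, a computation of polynomially many steps
   only produces numbers of polynomial bit-length, and is thus also
   polynomial-time on a Turing machine. *)
Section Machine.

Inductive data (R : Type) :=
| DNil
| DReal of R
| DCons of data R & data R.

Arguments DNil {R}.

Fixpoint data_size (R : Type) (d : data R) : nat :=
  if d is DCons d1 d2 then (data_size d1 + data_size d2).+1 else 1%N.

Definition data_hd (R : Type) (d : data R) : data R :=
  if d is DCons d1 _ then d1 else DNil.

Definition data_tl (R : Type) (d : data R) : data R :=
  if d is DCons _ d2 then d2 else DNil.

(* nil is false, everything else is true. *)
Definition data_true (R : Type) (d : data R) : bool :=
  if d is DNil then false else true.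

Definition data_bool (R : Type) (b : bool) : data R :=
  if b then DCons DNil DNil else DNil.

Definition data_add (R : realType) (d1 d2 : data R) : data R :=
  match d1, d2 with DReal x, DReal y => DReal (x + y) | _, _ => DNil end.

Definition data_sub (R : realType) (d1 d2 : data R) : data R :=
  match d1, d2 with DReal x, DReal y => DReal (x - y) | _, _ => DNil end.

Definition data_leq (R : realType) (d1 d2 : data R) : data R :=
  match d1, d2 with DReal x, DReal y => data_bool R (x <= y) | _, _ => DNil end.

(* Variables are de Bruijn indices into the environment. *)
Inductive expr :=
| EVar of nat
| ELet of expr & expr
| EIf of expr & expr & expr
| ECall of nat & expr
| ENil
| ECons of expr & expr
| EHd of expr
| ETl of expr
| EZero
| EAdd of expr & expr
| ESub of expr & expr
| ELeq of expr & expr.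

Definition program := seq expr.

(* [eval P env e v k]: in the environment [env], the expression [e] evaluates
   to [v] in exactly [k] time units. *)
Inductive eval (R : realType) (P : program) :
    seq (data R) -> expr -> data R -> nat -> Prop :=
| eval_var env i : eval P env (EVar i) (nth DNil env i) 1
| eval_let env e1 e2 v1 v2 k1 k2 :
    eval P env e1 v1 k1 -> eval P (v1 :: env) e2 v2 k2 ->
    eval P env (ELet e1 e2) v2 (k1 + k2).+1
| eval_if env e e1 e2 v w k l :
    eval P env e v k -> eval P env (if data_true v then e1 else e2) w l ->
    eval P env (EIf e e1 e2) w (k + l).+1
| eval_call env f e v w k l :
    eval P env e v k -> eval P [:: v] (nth ENil P f) w l ->
    eval P env (ECall f e) w (k + l).+1
| eval_nil env : eval P env ENil DNil 1
| eval_cons env e1 e2 v1 v2 k1 k2 :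
    eval P env e1 v1 k1 -> eval P env e2 v2 k2 ->
    eval P env (ECons e1 e2) (DCons v1 v2) (k1 + k2).+1
| eval_hd env e v k : eval P env e v k -> eval P env (EHd e) (data_hd v) k.+1
| eval_tl env e v k : eval P env e v k -> eval P env (ETl e) (data_tl v) k.+1
| eval_zero env : eval P env EZero (DReal 0) 1
| eval_add env e1 e2 v1 v2 k1 k2 :
    eval P env e1 v1 k1 -> eval P env e2 v2 k2 ->
    eval P env (EAdd e1 e2) (data_add v1 v2) (k1 + k2).+1
| eval_sub env e1 e2 v1 v2 k1 k2 :
    eval P env e1 v1 k1 -> eval P env e2 v2 k2 ->
    eval P env (ESub e1 e2) (data_sub v1 v2) (k1 + k2).+1
| eval_leq env e1 e2 v1 v2 k1 k2 :
    eval P env e1 v1 k1 -> eval P env e2 v2 k2 ->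
    eval P env (ELeq e1 e2) (data_leq v1 v2) (k1 + k2).+1.

Lemma eval_det (R : realType) (P : program) (env : seq (data R)) e v k :
  eval P env e v k -> forall v' k', eval P env e v' k' -> v' = v /\ k' = k.
Proof.
elim=> {env e v k} *;
  match goal with H : eval _ _ _ _ _ |- _ => inversion H; subst end;
  repeat match goal with
  | IH : forall v k, eval _ ?env ?e v k -> _, H : eval _ ?env ?e _ _ |- _ =>
      case: (IH _ _ H) => ? ?; subst; clear H
  end; by [].
Qed.

Definition runs_in (R : realType) (P : program) (input output : data R)
    (k : nat) : Prop :=
  eval P [:: input] (nth ENil P 0) output k.

End Machine.

Arguments DNil {R}.

Section Encoding.
Variables (R : realType) (n : nat).

(* Unary notation.  A connected graph on n vertices has at least n - 1 edges,
   so this affects the input size only polynomially. *)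
Definition enc_nat (i : nat) : data R := iter i (DCons DNil) DNil.

Definition enc_list (s : seq (data R)) : data R := foldr (@DCons R) DNil s.

Definition enc_vertices (V : {set 'I_n}) : data R :=
  enc_list [seq enc_nat i | i : 'I_n <- enum V].

Definition edge_pairs (E : {set {set 'I_n}}) : seq ('I_n * 'I_n) :=
  [seq p : 'I_n * 'I_n <- [seq (i, j) | i <- enum 'I_n, j <- enum 'I_n]
     | (p.1 < p.2)%N && adj E p.1 p.2].

Definition enc_edges (E : {set {set 'I_n}}) : data R :=
  enc_list [seq DCons (enc_nat p.1) (enc_nat p.2) | p : 'I_n * 'I_n <- edge_pairs E].

Definition enc_weighted_edges (E : {set {set 'I_n}}) (c : {set 'I_n} -> R) :
    data R :=
  enc_list [seq DCons (DCons (enc_nat p.1) (enc_nat p.2))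
                      (DReal (c [set p.1; p.2])) | p : 'I_n * 'I_n <- edge_pairs E].

Definition enc_stp (I : stp R n) : data R :=
  enc_list [:: enc_nat n; enc_weighted_edges (stp_edges I) (stp_cost I);
               enc_vertices (stp_terminals I)].

Definition enc_subgraph (S : subgraph n) : data R :=
  enc_list [:: enc_vertices (sverts S); enc_edges (sedges S)].

Definition enc_reopt (I : stp R n) (OPT : subgraph n) (I' : stp R n) : data R :=
  enc_list [:: enc_stp I; enc_subgraph OPT; enc_stp I'].

End Encoding.

(* Main.v *)
Require Import Defs.
From HB Require Import structures.
From mathcomp Require Import all_boot all_order all_algebra.
From mathcomp Require Import reals.
From mathcomp Require Import boolp.
From mathcomp Require Import lra zify ring.

Set Implicit Arguments.
Unset Strict Implicit.
Unset Printing Implicit Defensive.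

Import Order.TTheory GRing.Theory Num.Theory.
Local Open Scope ring_scope.

(** Let Q be the new terminals, and say that a list of edges of the metric closure
    is a network.  The Takahashi-Matsuyama heuristic [join_tree], which repeatedly
    joins the nearest missing vertex of a set Z to the tree, costs at most as much
    as any network on Z that connects Z.  The algorithm therefore only has to
    guess a good vertex set: it takes Q, together with the vertices where the
    paths from [t] to Q in an optimal tree of the old instance branch, changed in
    boundedly many places, and keeps the cheapest tree.

    Such a set exists by a local exchange argument.  By the Borchers-Du
    construction, the old optimum (without the path from [t] to its first branching
    vertex) and the new optimum decompose at relative cost [1 + 1 / (m + 1)] into
    families S and S' of components with boundedly many vertices that are connected
    through common terminals.  Start with the set C of the component of S next to [t].  Given C,
    boundedly many components Y of S' repair S without C, and boundedly many
    components of S, added to C to form C', repair S' without Y.  The latter is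
    feasible for the old instance, so that the optimality of the old tree yields
    cost (S - C + Y) <= cost S' + cost (C' - C), up to lower order terms.  As the
    sets C' - C of successive rounds are disjoint, one of them is cheap. *)

(** * Growing a tree *)

Section Functions.
Variable R : realType.

(** Errors must be measured against the new optimum, but [t] may be so remote that the old one costs
    arbitrarily more. Cutting off the path from [t] to the first branching vertex cures this. The
    rest has two subtrees at its apex; S' together with that path and a single leg from the apex
    down to a terminal is feasible for the old instance, so each subtree with its edge to the apex
    costs at most cost S'. The length of the cut path occurs on both sides of every comparison with
    the old optimum and cancels. The component next to [t] belongs to C from the start because C
    goes into the networks that must be feasible for the old instance, and the path from [t] ends at
    a point of that component. The algorithm never sees the decomposition S. It need not: apart from
    vertices of Q, the points of all components of S are exactly the branching vertices, however the
    tree was cut. Hence the vertex set to be guessed differs from the branching vertices together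
    with Q only at points of C and Y, and their number is bounded in terms of [eps] alone. *)

Definition edge : Type := (nat * nat) * R.
Definition entry : Type := (nat * R) * seq edge.
(* Vertices, edges (the last one added comes first) and cost. *)
Definition tree : Type := seq nat * (seq edge * R).

(* The list plays the role of an option, so that it can be consumed by [foldl]. *)
Definition argmin X (key : X -> R) (s : seq X) : seq X :=
  foldl (fun m x => if has (fun b => key b <= key x) m then m else [:: x])
    [::] s.

Definition reached (tbl : seq entry) : seq nat := [seq e.1.1 | e <- tbl].

Definition extensions (G : seq edge) (tbl : seq entry) : seq entry :=
  flatten [seq [seq ((g.1.2, e.1.2 + g.2), g :: e.2)
    | g <- [seq g <- G | (g.1.1 == e.1.1) && (g.1.2 \notin reached tbl)]]
    | e <- tbl].

Definition dijkstra_step (G : seq edge) (tbl : seq entry) : seq entry :=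
  argmin (fun e : entry => e.1.2) (extensions G tbl) ++ tbl.

(** [V] serves as a counter here: each round reaches a new vertex as long as one is left. All of
    [VT] starts at distance zero, so distances are measured from the whole tree. *)
Definition dijkstra (G : seq edge) (V VT : seq nat) : seq entry :=
  foldl (fun tbl _ => dijkstra_step G tbl)
    [seq ((v, 0), [::]) | v <- VT] V.

(** Skipping edges into vertices already present lets a walk cross the tree without closing a
    cycle. *)
Definition add_edge (tr : tree) (g : edge) : tree :=
  if g.1.2 \in tr.1 then tr
  else (g.1.2 :: tr.1, (g :: tr.2.1, tr.2.2 + g.2)).

Definition add_walk (tr : tree) (es : seq edge) : tree :=
  foldl add_edge tr (rev es).

Definition join_step (G : seq edge) (V Z : seq nat) (tr : tree) : tree :=
  foldl (fun tr (e : entry) => add_walk tr e.2) tr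
    (argmin (fun e : entry => e.1.2)
       [seq e <- dijkstra G V tr.1 | (e.1.1 \in Z) && (e.1.1 \notin tr.1)]).

(* The Takahashi-Matsuyama heuristic, from the last element of [Z]. *)
Definition join_tree (G : seq edge) (V Z : seq nat) : tree :=
  foldl (fun tr _ => join_step G V Z tr) ([:: last 0%N Z], ([::], 0)) Z.

Definition branching_step (s : seq nat * seq nat) (g : edge) :=
  if g.1.2 \in s.1 then
    if g.1.1 \in s.1 then (s.1, g.1.1 :: s.2) else (g.1.1 :: s.1, s.2)
  else s.

(* Going through the edges [(parent, child)] of a tree from the last one added,
   the first component collects the vertices with a descendant in [Q], and the
   second one those where two subtrees meeting [Q] are merged. *)
Definition branching (Q : seq nat) (es : seq edge) : seq nat :=
  (foldl branching_step (Q, [::]) es).2.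

Fixpoint lists m (V : seq nat) : seq (seq nat) :=
  if m is m'.+1 then
    [::] :: flatten [seq [seq v :: s | s <- lists m' V] | v <- V]
  else [:: [::]].

(** With a symmetric difference, the single list [D] encodes both the vertices to drop from [L] and
    those to add. *)
Definition swap (V Q L D : seq nat) : seq nat :=
  [seq v <- V | (v \in Q) || ((v \in L) (+) (v \in D))].

Definition sym_edges (G : seq edge) : seq edge :=
  G ++ [seq ((g.1.2, g.1.1), g.2) | g <- G].

(** The only element of [T] outside [Q] is [t]; placed last, it becomes the root. Rebuilding the old
    tree on its own vertices by [join_tree] turns it into a list of parent-child edges hanging from
    [t], as [branching] requires. *)
Definition candidates m (n : nat) (G : seq edge) (T VO Q : seq nat) :=
  let V := iota 0 n in
  let L := branching Q
    (join_tree G V (VO ++ [seq v <- T | v \notin Q])).2.1 in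
  [seq join_tree G V (swap V Q L D) | D <- lists m V].

Definition best (ts : seq tree) : tree :=
  last ([::], ([::], 0)) (argmin (fun t : tree => t.2.2) ts).

Definition has_edge (es : seq edge) (a b : nat) : bool :=
  has (fun h : edge => (h.1.1 == a) && (h.1.2 == b)
                    || (h.1.1 == b) && (h.1.2 == a)) es.

(** The final [unit] in these types stands for the [DNil] that ends an [enc_list], so that the
    generic encoding of pairs agrees with the prescribed one. *)
Definition stp_data : Type := nat * (seq edge * (seq nat * unit)).
Definition subgraph_data : Type := seq nat * (seq (nat * nat) * unit).
Definition reopt_data : Type := stp_data * (subgraph_data * (stp_data * unit)).

(** The result is read off by filtering [iota 0 n] and the input edges rather than by returning
    [tr]: the encoding of a subgraph fixes the order of its vertices and edges and the orientation
    of the latter. *)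
Definition reopt m (d : reopt_data) : subgraph_data :=
  let: (n, (G, (T, _)), ((VO, _), ((_, (_, (Q, _))), _))) := d in
  let tr := best (candidates m n (sym_edges G) T VO Q) in
  ([seq v <- iota 0 n | v \in tr.1],
   ([seq g.1 | g <- [seq g <- G | has_edge tr.2.1 g.1.1 g.1.2]], tt)).

End Functions.

Lemma ltn_count (X : eqType) (a1 a2 : pred X) (s : seq X) x :
  subpred a2 a1 -> x \in s -> a1 x -> ~~ a2 x -> (count a2 s < count a1 s)%N.
Proof.
move=> sub12; elim: s => // y s IHs; rewrite inE => /predU1P[<- a1x a2x|xs a1x a2x] /=.
  by rewrite a1x (negPf a2x) add0n add1n ltnS sub_count.
by have := IHs xs a1x a2x; have := @sub12 y; case: (a2 y) (a1 y) => [] [] //= h; lia.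
Qed.

(** * Shortest paths and the Takahashi-Matsuyama heuristic *)

Section JoinTree.
Variables (R : realType) (G : seq (edge R)) (V : seq nat).

Lemma argminP (X : eqType) (key : X -> R) (s : seq X) :
  s != [::] -> exists x, [/\ x \in s, argmin key s = [:: x]
    & forall y, y \in s -> key x <= key y].
Proof.
elim/last_ind: s => // s x IHs _; rewrite /argmin foldl_rcons -/(argmin key s).
have [-> /=|/IHs [y [ys -> min_y]]] := eqVneq s [::].
  by exists x; rewrite mem_head; split=> // y; rewrite inE => /eqP->.
rewrite /= orbF; case: ifP => [le_yx | /negbT lt_xy].
  exists y; split=> //; first by rewrite mem_rcons inE ys orbT.
  by move=> z; rewrite mem_rcons inE => /orP[/eqP-> //|/min_y].
exists x; split=> //; first by rewrite mem_rcons mem_head.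
move=> z; rewrite mem_rcons inE => /orP[/eqP-> //|/min_y]; apply: le_trans.
by apply: ltW; rewrite ltNge.
Qed.

Inductive walk (a : nat) : nat -> R -> Prop :=
| walk0 : walk a a 0
| walkS b c w x : walk a b w -> ((b, c), x) \in G -> walk a c (w + x).

Inductive walk_from (VT : seq nat) : seq (edge R) -> nat -> R -> Prop :=
| walk_from0 v : v \in VT -> walk_from VT [::] v 0
| walk_fromS es u v d x : walk_from VT es u d -> ((u, v), x) \in G ->
    walk_from VT (((u, v), x) :: es) v (d + x).

(** The child of the head edge is a leaf, so induction on this predicate strips leaves in the very
    order in which [branching] reads the edges. *)
Inductive grown (r : nat) : seq nat -> seq (edge R) -> R -> Prop :=
| grown1 : grown r [:: r] [::] 0
| grownS VT ET k u v x : grown r VT ET k -> u \in VT -> v \notin VT ->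
    ((u, v), x) \in G -> grown r (v :: VT) (((u, v), x) :: ET) (k + x).

Hypothesis G_ge0 : forall g : edge R, g \in G -> 0 <= g.2.
Hypothesis G_sym : forall (a b : nat) (x : R), ((a, b), x) \in G -> ((b, a), x) \in G.
Hypothesis G_in : forall (a b : nat) (x : R), ((a, b), x) \in G -> b \in V.
Hypothesis G_conn : forall a b : nat, a \in V -> b \in V -> exists w, walk a b w.

Lemma add_walkS (tr : tree R) g es :
  add_walk tr (g :: es) = add_edge (add_walk tr es) g.
Proof. by rewrite /add_walk rev_cons foldl_rcons. Qed.

Lemma add_walk_grown r VT ET k es v d (tr := add_walk (VT, (ET, k)) es) :
  grown r VT ET k -> walk_from VT es v d ->
  [/\ grown r tr.1 tr.2.1 tr.2.2, {subset VT <= tr.1}, v \in tr.1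
    & tr.2.2 <= k + d].
Proof.
move=> gr; rewrite /tr {tr}; elim=> {es v d} [v vVT|es u v d x _ IH Gx].
  by split; rewrite ?addr0.
rewrite add_walkS /add_edge /=; case: ifP => [v_in|/negbT v_nin]; last first.
  case: IH => gr' sub u_in le_k; split=> //=.
  - exact: (grownS gr').
  - by move=> y /sub; rewrite inE orbC => ->.
  - by rewrite mem_head.
  - by rewrite addrA lerD2r.
case: IH => gr' sub u_in le_k; split=> //.
by rewrite addrA (le_trans le_k) // lerDl; apply: (G_ge0 Gx).
Qed.

Definition dijkstra_inv VT (tbl : seq (entry R)) : Prop :=
  [/\ forall e, e \in tbl -> walk_from VT e.2 e.1.1 e.1.2,
      {subset VT <= reached tbl}
    & forall e a w, e \in tbl -> a \in VT -> walk a e.1.1 w -> e.1.2 <= w].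

Lemma mem_extensions e tbl :
  reflect (exists e' x, [/\ e' \in tbl, ((e'.1.1, e.1.1), x) \in G,
     e.1.1 \notin reached tbl &
     e = ((e.1.1, e'.1.2 + x), ((e'.1.1, e.1.1), x) :: e'.2)])
    (e \in extensions G tbl).
Proof.
apply: (iffP flatten_mapP) => [[e' e'_in /mapP[g]]|[e' [x [e'_in Gx nr ->]]]].
  rewrite mem_filter => /andP[/andP[/eqP g1 nr] gG] ->.
  by exists e', g.2; rewrite -g1 /=; case: g {g1} gG nr => -[a b] x.
exists e' => //; apply/mapP; exists ((e'.1.1, e.1.1), x) => //.
by rewrite mem_filter /= eqxx nr.
Qed.

Lemma dijkstra_stepP VT tbl : dijkstra_inv VT tbl ->
  dijkstra_inv VT (dijkstra_step G tbl).
Proof.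
move=> [walk_tbl sub_tbl min_tbl]; rewrite /dijkstra_step.
have [->//|] := eqVneq (extensions G tbl) [::].
move=> /(argminP (fun e : entry R => e.1.2))[e [e_in -> min_e]] /=.
have [e' [x [e'_in Gx nr def_e]]] := mem_extensions _ _ e_in.
split=> [f|v /sub_tbl|f a w].
- rewrite inE => /orP[/eqP->|/walk_tbl//]; rewrite def_e /=.
  exact: walk_fromS (walk_tbl _ e'_in) Gx.
- by rewrite inE orbC => ->.
rewrite inE => /orP[/eqP->|/min_tbl h]; last exact: h.
move=> aVT walk_ae.
(* The claim is generalized to all prefixes of the walk: either the current endpoint is in the
   table, or the new key is at most the length so far. The edge on which the walk leaves the table
   is an extension, which competes with [e]. *)
suff /orP[/(negP nr)[]|//] : (e.1.1 \in reached tbl) || (e.1.2 <= w).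
have nr_e : e.1.1 \notin reached tbl by rewrite def_e in nr *.
elim: walk_ae => [|b c {}w y walk_ab IHw Gy]; first by rewrite sub_tbl.
have y_ge0 : 0 <= y := G_ge0 Gy; case: (boolP (c \in _)) => //= c_nr.
case/orP: IHw => [/mapP[h h_in def_b]|le_w]; last by lra.
have le_h : h.1.2 <= w by apply: (min_tbl _ a) => //; rewrite -def_b.
suff : e.1.2 <= h.1.2 + y by lra.
apply: (min_e ((c, h.1.2 + y), ((h.1.1, c), y) :: h.2)).
by apply/mem_extensions; exists h, y; split=> //=; rewrite -def_b.
Qed.

(** A walk from [a] to the unreached [v] has to leave the table somewhere, and there it provides an
    extension. *)
Lemma reached_step a VT tbl v : dijkstra_inv VT tbl ->
  a \in VT -> {subset VT <= V} -> v \in V -> v \notin reached tbl ->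
  exists2 u, u \in V & u \notin reached tbl /\
    reached (dijkstra_step G tbl) = u :: reached tbl.
Proof.
move=> [walk_tbl sub_tbl min_tbl] aVT VTV vV v_nr; rewrite /dijkstra_step.
have [ext0|] := eqVneq (extensions G tbl) [::]; last first.
  move=> /(argminP (fun e : entry R => e.1.2))[e [e_in -> min_e]] /=.
  have [e' [x [e'_in Gx nr def_e]]] := mem_extensions _ _ e_in.
  by exists e.1.1; first exact: G_in Gx.
have [w walk_av] := G_conn (VTV _ aVT) vV.
case/negP: v_nr; elim: walk_av => [|b c {}w y _ /mapP[f f_in def_b] Gy].
  exact: sub_tbl.
apply: contraT => c_nr; suff: (((c, f.1.2 + y), ((f.1.1, c), y) :: f.2) : entry R)
  \in extensions G tbl by rewrite ext0.
by apply/mem_extensions; exists f, y; split=> //=; rewrite -def_b.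
Qed.

Lemma dijkstraP a VT (tbl := dijkstra G V VT) :
  a \in VT -> {subset VT <= V} ->
  dijkstra_inv VT tbl /\ {subset V <= reached tbl}.
Proof.
move=> aVT VTV; rewrite /tbl /dijkstra {tbl}.
pose unreached (tbl : seq (entry R)) := count (fun v => v \notin reached tbl) V.
have inv0 : dijkstra_inv VT [seq ((v, 0), [::]) | v <- VT].
  split=> [e /mapP[v vVT ->]|v vVT|e b w /mapP[v vVT ->] _ /=].
  - exact: walk_from0.
  - by rewrite /reached -map_comp map_id.
  elim=> {v vVT w} [|u v w x _ w_ge0 Gx] //.
  by rewrite addr_ge0 // (G_ge0 Gx).
have inv s tbl : dijkstra_inv VT tbl ->
    let tbl' := foldl (fun tbl (_ : nat) => dijkstra_step G tbl) tbl s in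
    dijkstra_inv VT tbl' /\ (unreached tbl' <= unreached tbl - size s)%N.
  elim: s tbl => [|y s IHs] tbl inv /=; first by rewrite subn0.
  have [inv' le_un] := IHs _ (dijkstra_stepP inv).
  split=> //; apply: leq_trans le_un _; rewrite -add1n subnDA leq_sub2r //.
  have [/allP all_r|/allPn[u uV u_nr]] := boolP (all (mem (reached tbl)) V).
    suff -> : unreached (dijkstra_step G tbl) = 0%N by [].
    apply/eqP; rewrite -leqn0 leqNgt -has_count; apply/hasPn => u uV.
    have := all_r u uV.
    by rewrite negbK /dijkstra_step /reached map_cat mem_cat /= orbC => ->.
  have [u' u'V [u'_nr step_r]] := reached_step inv aVT VTV uV u_nr.
  suff : (unreached (dijkstra_step G tbl) < unreached tbl)%N by lia.
  rewrite /unreached step_r; apply: (ltn_count (x := u')) => //.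
    by move=> v; rewrite inE negb_or => /andP[].
  by rewrite mem_head.
have [inv1] := inv V _ inv0; set tbl1 := foldl _ _ V => le_un.
split=> // v vV; apply: contraT => v_nr.
have un_gt0 : (0 < unreached tbl1)%N by rewrite -has_count; apply/hasP; exists v.
have := leq_trans un_gt0 le_un.
by rewrite subn_gt0 ltnNge count_size.
Qed.

Lemma grown_sub r VT ET k : r \in V -> grown r VT ET k -> {subset VT <= V}.
Proof.
move=> rV; elim=> {VT ET k} [v|VT ET k u v x _ IH _ _ Gx y]; rewrite inE.
  by move/eqP->.
by case/predU1P=> [->|/IH//]; apply: G_in Gx.
Qed.

Lemma grown_root r VT ET k : grown r VT ET k -> r \in VT.
Proof.
by elim=> {VT ET k} [|VT ET k u v x _ IH _ _ _]; rewrite ?mem_head // inE IH orbT.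
Qed.

Definition grown_tree r (tr : tree R) : Prop := grown r tr.1 tr.2.1 tr.2.2.

Lemma join_stepP r Z tr (tr' := join_step G V Z tr) :
  r \in V -> {subset Z <= V} -> grown_tree r tr ->
  {subset Z <= tr.1} /\ tr' = tr \/
  exists z d, [/\ grown_tree r tr', {subset tr.1 <= tr'.1},
     [/\ z \in Z, z \notin tr.1 & z \in tr'.1], tr'.2.2 <= tr.2.2 + d &
     forall a z' w, a \in tr.1 -> z' \in Z -> z' \notin tr.1 -> walk a z' w ->
       d <= w].
Proof.
move=> rV ZV gr; have VTV := grown_sub rV gr; have rVT := grown_root gr.
have [[walk_t _ min_t] all_t] := dijkstraP rVT VTV.
rewrite /tr' /join_step {tr'}; set c := filter _ _.
have cP z : z \in Z -> z \notin tr.1 -> exists2 e, e \in c & e.1.1 = z.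
  move=> zZ z_nin; have /mapP[e e_in z_def] := all_t _ (ZV _ zZ).
  by exists e; rewrite // mem_filter -z_def zZ z_nin.
have [c0|] := eqVneq c [::].
  left; rewrite c0; split=> // z zZ; apply: contraT => /(cP _ zZ)[e].
  by rewrite c0.
move=> /(argminP (fun e : entry R => e.1.2))[e [+ -> min_e]] /=.
rewrite mem_filter => /andP[/andP[eZ e_nin] e_in]; right.
exists e.1.1, e.1.2.
have [gr' sub e_in' le_k] : [/\ grown_tree r (add_walk tr e.2),
    {subset tr.1 <= (add_walk tr e.2).1}, e.1.1 \in (add_walk tr e.2).1
    & (add_walk tr e.2).2.2 <= tr.2.2 + e.1.2].
  case: tr {rVT VTV walk_t min_t all_t cP c min_e e_nin} gr e_in (walk_t _ e_in)
    => VT [ET k] gr _ h.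
  exact: add_walk_grown.
split=> // a z' w aVT z'Z z'_nin.
have [f f_in <-] := cP _ z'Z z'_nin => walk_f; apply: le_trans (min_e _ f_in) _.
by apply: min_t walk_f => //; move: f_in; rewrite mem_filter => /andP[].
Qed.

Lemma join_tree_grown Z (tr := join_tree G V Z) :
  last 0%N Z \in V -> {subset Z <= V} ->
  grown_tree (last 0%N Z) tr /\ {subset Z <= tr.1}.
Proof.
move=> rV ZV; pose missing (t : tree R) := count (fun z => z \notin t.1) Z.
have inv s t : grown_tree (last 0%N Z) t ->
    let t' := foldl (fun t (_ : nat) => join_step G V Z t) t s in
    grown_tree (last 0%N Z) t' /\ (missing t' <= missing t - size s)%N.
  elim: s t => [|y s IHs] t gr /=; first by rewrite subn0.
  have [[ZT ->]|[z [d [gr' sub [zZ z_nin z_in] _ _]]]] := join_stepP rV ZV gr.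
    have [gr' le_m] := IHs t gr; split=> //; apply: leq_trans le_m _.
    suff -> : missing t = 0%N by [].
    apply/eqP; rewrite -leqn0 leqNgt -has_count; apply/hasPn => z /ZT.
    by rewrite negbK.
  have [gr'' le_m] := IHs _ gr'; split=> //; apply: leq_trans le_m _.
  suff : (missing (join_step G V Z t) < missing t)%N by lia.
  apply: (ltn_count (x := z)) => //; last by rewrite negbK.
  by move=> v; apply: contraNN => /sub.
have gr0 : grown_tree (last 0%N Z) ([:: last 0%N Z], ([::], 0)) by apply: grown1.
have [gr le_m] := inv Z _ gr0; split=> // z zZ; apply: contraT => z_nin.
have m_gt0 : (0 < missing tr)%N by rewrite -has_count; apply/hasP; exists z.
by have := leq_trans m_gt0 le_m; rewrite subn_gt0 ltnNge count_size.
Qed.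

Lemma walk_ge0 a b w : walk a b w -> 0 <= w.
Proof. by elim=> // {}b c {}w x _ w_ge0 Gx; rewrite addr_ge0 // (G_ge0 Gx). Qed.

Lemma walk_trans a b c w x : walk a b w -> walk b c x -> walk a c (w + x).
Proof.
move=> walk_ab; elim=> [|d e {}x y _ IH Gy]; first by rewrite addr0.
by rewrite addrA; apply: walkS IH Gy.
Qed.

Lemma walk_sym a b w : walk a b w -> walk b a w.
Proof.
elim=> [|c d {}w x _ IH /G_sym Gx]; first exact: walk0.
by rewrite addrC; apply: walk_trans IH; rewrite -[x]add0r; apply: walkS Gx; apply: walk0.
Qed.

Definition near a b w : Prop := exists2 w', w' <= w & walk a b w'.

Lemma near_trans a b c w x : near a b w -> near b c x -> near a c (w + x).
Proof.
move=> [w' le_w walk_w] [x' le_x walk_x]; exists (w' + x'); first exact: lerD.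
exact: walk_trans walk_x.
Qed.

Lemma near_sym a b w : near a b w -> near b a w.
Proof. by case=> w' le_w /walk_sym; exists w'. Qed.

Lemma near_refl a : near a a 0.
Proof. by exists 0 => //; apply: walk0. Qed.

Lemma near_ge0 a b w : near a b w -> 0 <= w.
Proof. by case=> w' le_w /walk_ge0/le_trans; apply. Qed.

End JoinTree.

(** * Networks in the metric closure *)

Section Networks.
Variable R : realType.

(* Reachability, in the form of its induction principle. *)
Definition conn (L : nat -> nat -> Prop) (x y : nat) : Prop :=
  forall U : nat -> Prop, (forall a b, L a b -> U a -> U b) -> U x -> U y.

Lemma conn_refl L x : conn L x x.
Proof. by []. Qed.

Lemma conn_trans L y x z : conn L x y -> conn L y z -> conn L x z.
Proof. by move=> xy yz U UL Ux; exact: (yz U UL (xy U UL Ux)). Qed.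

Lemma conn1 (L : nat -> nat -> Prop) x y : L x y -> conn L x y.
Proof. by move=> Lxy U UL; apply: UL. Qed.

Lemma conn_sym (L : nat -> nat -> Prop) x y :
  (forall a b, L a b -> L b a) -> conn L x y -> conn L y x.
Proof.
move=> Lsym xy; apply: (xy (fun z => conn L z x)) => [a b Lab ax|];
  last exact: conn_refl.
exact: conn_trans (conn1 (Lsym _ _ Lab)) ax.
Qed.

Lemma conn_sub (L L' : nat -> nat -> Prop) x y :
  (forall a b, L a b -> conn L' a b) -> conn L x y -> conn L' x y.
Proof.
move=> sub xy; apply: (xy (conn L' x)); last exact: conn_refl.
by move=> a b /sub ab xa; apply: conn_trans ab.
Qed.

Definition link (N : seq (edge R)) (a b : nat) : Prop :=
  exists x, ((a, b), x) \in N \/ ((b, a), x) \in N.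

Lemma link_sym N a b : link N a b -> link N b a.
Proof. by case=> x [] h; exists x; [right|left]. Qed.

Lemma link_sub (N N' : seq (edge R)) a b :
  {subset N <= N'} -> link N a b -> link N' a b.
Proof. by move=> sub [x [] /sub h]; exists x; [left|right]. Qed.

Definition net_cost (N : seq (edge R)) : R := \sum_(g <- N) g.2.

Definition metric G (N : seq (edge R)) : Prop :=
  forall a b x, ((a, b), x) \in N -> near G a b x.

Definition within (N : seq (edge R)) (Z : seq nat) : Prop :=
  forall a b x, ((a, b), x) \in N -> a \in Z /\ b \in Z.

Definition spans (N : seq (edge R)) (Z : seq nat) : Prop :=
  forall x y, x \in Z -> y \in Z -> conn (link N) x y.

Variables (G : seq (edge R)) (V : seq nat).
Hypothesis G_ge0 : forall g : edge R, g \in G -> 0 <= g.2.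
Hypothesis G_sym : forall (a b : nat) (x : R), ((a, b), x) \in G -> ((b, a), x) \in G.
Hypothesis G_in : forall (a b : nat) (x : R), ((a, b), x) \in G -> b \in V.
Hypothesis G_conn : forall a b : nat, a \in V -> b \in V -> exists w, walk G a b w.

Lemma net_cost_ge0 N : metric G N -> 0 <= net_cost N.
Proof.
move=> metN; rewrite /net_cost big_seq sumr_ge0 // => -[[a b] x] /metN.
exact: near_ge0.
Qed.

(* An edge of the network leaving the tree on the way from [z] can be traded for
   a path joining [z] to the tree. *)
Lemma join_tree_cost Z N : Z != [::] -> {subset Z <= V} ->
  metric G N -> within N Z -> spans N Z ->
  (join_tree G V Z).2.2 <= net_cost N.
Proof.
move=> Z0 ZV metN inN spanN; set r := last 0%N Z.
have rZ : r \in Z by rewrite /r; case: (Z) Z0 => // v s _; apply: mem_last.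
have rV := ZV _ rZ.
(* As in Prim's algorithm, [N'] is the part of the network not yet spent. It still ties every vertex
   of [Z] to the tree, and together with the tree it stays within the budget. *)
pose inv (t : tree R) := grown_tree G r t /\ exists N', [/\ {subset N' <= N},
  forall z, z \in Z -> exists2 y, y \in t.1 & conn (link N') z y
  & t.2.2 + net_cost N' <= net_cost N].
suff : inv (join_tree G V Z).
  case=> _ [N' [subN' _]]; have := @net_cost_ge0 N'.
  move=> /(_ (fun a b x h => metN _ _ _ (subN' _ h))); lra.
have inv0 : inv ([:: r], ([::], 0)).
  split; first exact: grown1.
  exists N; split; rewrite ?add0r // => z zZ.
  by exists r; [rewrite mem_head | apply: spanN].
suff inv_step t : inv t -> inv (join_step G V Z t).
  have inv_fold s t : inv t ->
      inv (foldl (fun t (_ : nat) => join_step G V Z t) t s).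
    by elim: s t => //= y s IHs t /inv_step/IHs.
  exact: inv_fold.
move=> [gr [N' [subN' conN' le_N]]].
have [[_ ->]|] := join_stepP G_ge0 G_in G_conn rV ZV gr.
  by split=> //; exists N'.
set t' := join_step _ _ _ _ => -[z [d [gr' sub [zZ z_nin z_in] le_d min_d]]].
split=> //.
(* Along [N'] from the newly joined [z], the first link entering the old tree is the one to trade.
   Its outer end [a] lies in [Z], because the network stays within [Z], and was still missing; so
   the link is at least as long as the shortest connection [d]. *)
pose outer a b := exists x, [/\ ((a, b), x) \in N' \/ ((b, a), x) \in N',
  a \notin t.1 & b \notin t.1].
have [a [b [x [za a_nin b_in Nx]]]] : exists a b x, [/\ conn outer z a,
    a \notin t.1, b \in t.1 & ((a, b), x) \in N' \/ ((b, a), x) \in N'].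
  apply: contrapT => none; have [v v_in zv] := conN' z zZ.
  suff [] : v \notin t.1 /\ conn outer z v by rewrite v_in.
  apply: (zv (fun v => v \notin t.1 /\ conn outer z v)) => [a b [x Nx]|];
    last by split=> //; apply: conn_refl.
  move=> [a_nin za]; have [b_in|b_nin] := boolP (b \in t.1).
    by case: none; exists a, b, x.
  by split=> //; apply: conn_trans za _; apply: conn1; exists x.
have x_ge : d <= x.
  have aZ : a \in Z by case: Nx => /subN'/inN[].
  have [v vT va] := conN' z zZ.
  have near_ba : near G b a x by case: Nx => /subN'/metN; [apply: near_sym|].
  by case: near_ba => w le_w walk_w; apply: le_trans le_w; apply: (min_d b a).
have [g gN' [gx g1]] : exists2 g, g \in N' &
    g.2 = x /\ (g.1 = (a, b) \/ g.1 = (b, a)).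
  by case: Nx => h; eexists; [exact: h| |exact: h|]; split; auto.
have perm_N' := perm_to_rem gN'.
have in_rem e : e \in N' -> e = g \/ e \in rem g N'.
  by rewrite (perm_mem perm_N') inE => /predU1P.
(* Without [g] both of its ends still reach the new tree: [b] lies in it, and [a] leads back to [z]
   along links avoiding the old tree, hence different from [g]. *)
pose joined v := exists2 y, y \in t'.1 & conn (link (rem g N')) v y.
have joined_b : joined b by exists b; [apply: sub | apply: conn_refl].
have joined_a : joined a.
  exists z => //; apply: conn_sym; first exact: link_sym.
  apply: conn_sub za => u v [y [Ny u_nin v_nin]]; apply: conn1; exists y.
  by case: Ny => /in_rem[def_g|]; auto; move: g1 u_nin v_nin;
    rewrite -def_g /= => -[] [-> ->]; rewrite b_in.
exists (rem g N'); split.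
- by move=> e /mem_rem/subN'.
- move=> z' /conN'[v vT /(conn_sym (@link_sym _)) vz'].
  apply: (vz' joined) => [u w [y Ny] [y' y'T uy']|].
    have [->//|w_ne_b] := eqVneq w b; have [->//|w_ne_a] := eqVneq w a.
    exists y' => //; apply: conn_trans uy'; apply: conn1; apply: link_sym; exists y.
    case: Ny => /in_rem[def_g|]; auto; exfalso; move: g1; rewrite -def_g /=.
      by case=> -[_ /eqP]; rewrite ?(negPf w_ne_a) ?(negPf w_ne_b).
    by case=> -[/eqP]; rewrite ?(negPf w_ne_a) ?(negPf w_ne_b).
  by exists v; [apply: sub | apply: conn_refl].
have : net_cost N' = x + net_cost (rem g N').
  by rewrite /net_cost (perm_big _ perm_N') big_cons gx.
by move: le_N le_d x_ge; rewrite -/t'; lra.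
Qed.

End Networks.

(** * Binary trees and their components *)

Section BinaryTrees.
Variable R : realType.

(* [Node v wl l wr r] has children [l] and [r], at distance at most [wl] and
   [wr] from [v]; the terminals are at the leaves. *)
Inductive btree :=
| Leaf of nat
| Node of nat & R & btree & R & btree.

Definition apex (b : btree) : nat :=
  match b with Leaf v => v | Node v _ _ _ _ => v end.

Fixpoint leaves (b : btree) : seq nat :=
  if b is Node _ _ l _ r then leaves l ++ leaves r else [:: apex b].

Fixpoint labels (b : btree) : seq nat :=
  if b is Node v _ l _ r then v :: labels l ++ labels r else [::].

Fixpoint weight (b : btree) : R :=
  if b is Node _ wl l wr r then wl + weight l + (wr + weight r) else 0.

Variables (G : seq (edge R)) (V : seq nat).
Hypothesis G_ge0 : forall g : edge R, g \in G -> 0 <= g.2.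

Fixpoint realized (b : btree) : Prop :=
  if b is Node v wl l wr r then
    [/\ near G v (apex l) wl, near G v (apex r) wr, realized l & realized r]
  else True.

Lemma weight_ge0 b : realized b -> 0 <= weight b.
Proof.
elim: b => //= v wl l IHl wr r IHr.
move=> [/(near_ge0 G_ge0) wl0 /(near_ge0 G_ge0) wr0 /IHl l0 /IHr r0].
by lra.
Qed.

Lemma grown_uniq r VT ET k : grown G r VT ET k -> uniq VT.
Proof. by elim=> // {VT ET k} VT ET k u v x _ IH _ v_nin _; rewrite /= v_nin. Qed.

(** * Contracting a grown tree to its branching vertices *)

Definition oweight (o : option (R * btree)) : R :=
  if o is Some p then p.1 + weight p.2 else 0.

Definition oleaves (o : option (R * btree)) : seq nat :=
  if o is Some p then leaves p.2 else [::].

Definition olabels (o : option (R * btree)) : seq nat :=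
  if o is Some p then labels p.2 else [::].

(* [F v] describes the part of the tree below [v] that has already been
   processed, if it contains a terminal. *)
Lemma extract_btree r VT ET k : grown G r VT ET k ->
  forall (F : nat -> option (R * btree)) (alive Q L : seq nat),
  (forall v, v \in VT -> (v \in alive) = isSome (F v)) ->
  (forall v p, v \in VT -> F v = Some p -> near G v (apex p.2) p.1 /\ realized p.2) ->
  (exists2 v, v \in VT & v \in alive) ->
  (forall q, q \in Q <-> exists2 v, v \in VT & q \in oleaves (F v)) ->
  (forall q, q \in L <-> exists2 v, v \in VT & q \in olabels (F v)) ->
  exists w b, [/\ near G r (apex b) w, realized b,
    w + weight b <= k + \sum_(v <- VT) oweight (F v), leaves b =i Q &
    labels b =i (foldl (@branching_step R) (alive, L) ET).2].
Proof.
elim=> {VT ET k} [|VT ET k u v x gr IH uVT v_nin Gx] F alive Q L Fal Fok Fex FQ FL.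
  case: Fex => r'; rewrite inE => /eqP-> {r'}; rewrite Fal ?mem_head //.
  case Fr: (F r) => [[w b]|//] _.
  have [near_rb ok_b] := Fok r _ (mem_head _ _) Fr.
  exists w, b; split=> //= [|q|q].
  - by rewrite big_seq1 Fr add0r.
  - by apply/idP/idP => [qb|/FQ[v]]; [apply/FQ; exists r; rewrite ?mem_head ?Fr
      | rewrite inE => /eqP->; rewrite Fr].
  - by apply/idP/idP => [qb|/FL[v]]; [apply/FL; exists r; rewrite ?mem_head ?Fr
      | rewrite inE => /eqP->; rewrite Fr].
have u_ne_v : u != v by apply: contraNneq v_nin => <-.
have in_VT y : y \in VT -> y \in v :: VT by rewrite inE orbC => ->.
have x_ge0 : 0 <= x := G_ge0 Gx.
rewrite /= /branching_step /= Fal ?mem_head //.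
case Fv: (F v) => [[w2 b2]|] /=; last first.
  have [|||||w [b [h1 h2 h3 h4 h5]]] := IH F alive Q L.
  - by move=> y /in_VT/Fal.
  - by move=> y p /in_VT; apply: Fok.
  - case: Fex => y; rewrite inE => /predU1P[->|]; last by exists y.
    by rewrite Fal ?mem_head ?Fv.
  - move=> q; rewrite FQ; split=> [[y]|[y /in_VT]]; last by exists y.
    by rewrite inE => /predU1P[->|]; [rewrite Fv|exists y].
  - move=> q; rewrite FL; split=> [[y]|[y /in_VT]]; last by exists y.
    by rewrite inE => /predU1P[->|]; [rewrite Fv|exists y].
  exists w, b; split=> //; rewrite big_cons Fv /= add0r.
  by apply: le_trans h3 _; rewrite lerD2r lerDl.
have [near_v2 ok2] := Fok v _ (mem_head _ _) Fv; rewrite /= in near_v2 ok2.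
have near_uv : near G u v x.
  by exists x => //; rewrite -[x]add0r; apply: walkS Gx; apply: walk0.
have near_u2 := near_trans near_uv near_v2.
(* The leaf [v] is merged into its parent [u]. If [u] carries nothing yet, the path above [b2] grows
   by [x], which suppresses vertices of degree two. Otherwise a node labelled [u] arises, exactly
   when [branching_step] records [u]; a vertex with many children becomes a chain of nodes joined by
   edges of weight zero. *)
pose m := if F u is Some p then (0, Node u p.1 p.2 (x + w2) b2) else (x + w2, b2).
pose F' y := if y == u then Some m else F y.
set alive' := (X in foldl _ X ET).
have def_alive' : alive' = (if u \in alive then alive else u :: alive,
    if u \in alive then u :: L else L) by rewrite /alive'; case: ifP.
rewrite {}def_alive' {alive'}.
have F'u : F' u = Some m by rewrite /F' eqxx.
have F'E y : y != u -> F' y = F y by rewrite /F' => /negPf->.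
have u_al : (u \in alive) = isSome (F u) by rewrite Fal // in_VT.
have mem_split (o : option (R * btree) -> seq nat) (ex : seq nat) q :
    (forall q, q \in o (Some m) = [|| q \in ex, q \in o (F u) | q \in o (F v)]) ->
    (q \in ex \/ exists2 y, y \in v :: VT & q \in o (F y)) <->
    (exists2 y, y \in VT & q \in o (F' y)).
  move=> om; split=> [[qex|[y]]|[y yVT]].
  - by exists u; rewrite // F'u om qex.
  - rewrite inE => /predU1P[->|yVT] qy; first by exists u; rewrite // F'u om qy !orbT.
    have [y_u|y_ne] := eqVneq y u; last by exists y; rewrite ?F'E.
    by exists u; rewrite // F'u om -y_u qy orbT.
  have [->|y_ne] := eqVneq y u.
    rewrite F'u om => /or3P[qex|qu|qv]; first by left.
      by right; exists u; rewrite ?in_VT.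
    by right; exists v; rewrite ?mem_head.
  by rewrite F'E // => qy; right; exists y; rewrite ?in_VT.
have [|||||w [b [h1 h2 h3 h4 h5]]] := IH F' (if u \in alive then alive else u :: alive)
    Q (if u \in alive then u :: L else L).
- move=> y yVT; have [->|y_ne] := eqVneq y u.
    by rewrite F'u; case: ifP => //; rewrite mem_head.
  by rewrite F'E // -Fal ?in_VT //; case: ifP; rewrite // inE (negPf y_ne).
- move=> y p yVT; have [->|y_ne] := eqVneq y u; last first.
    by rewrite F'E // => /Fok; apply; rewrite in_VT.
  rewrite F'u => -[<-] {p}; rewrite /m; case Fu: (F u) => [[w1 b1]|] //=.
  have [near_u1 ok1] := Fok u _ (in_VT _ uVT) Fu.
  by split; [exact: near_refl | split].
- by exists u => //; case: ifP => //; rewrite mem_head.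
- move=> q; rewrite FQ -(mem_split oleaves [::]); last first.
    by move=> q'; rewrite /m Fv; case: (F u) => [[w1 b1]|] //=; rewrite mem_cat.
  by split=> [|[]//]; right.
- move=> q; rewrite -(mem_split olabels (if isSome (F u) then [:: u] else [::])); last first.
    by move=> q'; rewrite /m Fv; case: (F u) => [[w1 b1]|] //=; rewrite !inE mem_cat.
  rewrite u_al; case: (isSome _); last by rewrite FL; split=> [|[]//]; right.
  by rewrite !inE -FL; split=> [/predU1P[->|]|[/eqP->|->]]; rewrite ?eqxx ?orbT; auto.
exists w, b; split=> //.
  apply: le_trans h3 _; rewrite big_cons Fv /= -addrA lerD2l.
  have uniqVT := grown_uniq gr.
  rewrite !(big_rem u uVT) /= F'u.
  have -> : \sum_(y <- rem u VT) oweight (F' y) = \sum_(y <- rem u VT) oweight (F y).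
    by apply: eq_big_seq => y; rewrite mem_rem_uniq // inE => /andP[y_ne _]; rewrite F'E.
  by rewrite /m; case: (F u) => [[w1 b1]|] /=; lra.
Qed.

(* The terminals and the edges of a full component. *)
Definition block : Type := seq nat * seq (edge R).

Definition points (B : block) : seq nat :=
  B.1 ++ flatten [seq [:: g.1.1; g.1.2] | g <- B.2].

Lemma mem_points_edge (B : block) g : g \in B.2 ->
  (g.1.1 \in points B) && (g.1.2 \in points B).
Proof.
move=> gB; rewrite !mem_cat; apply/andP; split; apply/orP; right;
  by apply/flatten_mapP; exists g; rewrite // !inE eqxx ?orbT.
Qed.

Definition good_block (K : nat) (Q : seq nat) (B : block) : Prop :=
  [/\ B.1 != [::], {subset B.1 <= Q}, metric G B.2,
      spans B.2 (points B) & (size (points B) <= K)%N].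

Definition tlink (bs : seq block) (a b : nat) : Prop :=
  exists2 B, B \in bs & a \in B.1 /\ b \in B.1.

(** * The Borchers-Du decomposition *)

Fixpoint leftmost (b : btree) : nat * R :=
  match b with
  | Leaf v => (v, 0)
  | Node _ wl l _ _ => ((leftmost l).1, wl + (leftmost l).2)
  end.

(* The component of the top [h] levels of a tree.  Each node [v] at depth [h] is
   joined to a leaf by the path that first goes right and then always left;
   these paths are edge-disjoint. *)
Fixpoint top (b : btree) (h : nat) : block :=
  match b with
  | Leaf v => ([:: v], [::])
  | Node v wl l wr r =>
    if h is h'.+1 then
      ((top l h').1 ++ (top r h').1,
       ((v, apex l), wl) :: ((v, apex r), wr) :: (top l h').2 ++ (top r h').2)
    else ([:: (leftmost r).1],
          [:: ((v, (leftmost r).1), wr + (leftmost r).2)])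
  end.

Variable m : nat.

(** The tree is cut at depths [h], [h + m.+1], [h + 2 * m.+1] and so on. An inner node at such a
    depth is a bottom point of one component and the root of the next. *)
Fixpoint below (b : btree) (h : nat) : seq block :=
  match b with
  | Leaf v => [::]
  | Node v wl l wr r =>
    if h is h'.+1 then below l h' ++ below r h'
    else top b m.+1 :: below l m ++ below r m
  end.

Definition blocks b h := top b h :: below b h.

Definition blocks_cost (bs : seq block) : R := \sum_(B <- bs) net_cost B.2.

Fixpoint detours (b : btree) : R :=
  if b is Node _ wl l wr r then
    wr + (leftmost r).2 + detours l + detours r else 0.

(** The detour of a node continues along the leftmost path of its right child. This path must
    therefore be kept free of other detours, which is why its length appears in the induction
    hypothesis. *)
Lemma detours_le b : detours b + (leftmost b).2 <= weight b.
Proof. by elim: b => [v|v wl l IHl wr r IHr] /=; lra. Qed.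

Lemma blocks_cost_cons B bs : blocks_cost (B :: bs) = net_cost B.2 + blocks_cost bs.
Proof. exact: big_cons. Qed.

Lemma blocks_cost_cat bs1 bs2 :
  blocks_cost (bs1 ++ bs2) = blocks_cost bs1 + blocks_cost bs2.
Proof. exact: big_cat. Qed.

Lemma blocks_costS v wl l wr r h :
  blocks_cost (blocks (Node v wl l wr r) h.+1) =
  wl + wr + blocks_cost (blocks l h) + blocks_cost (blocks r h).
Proof.
rewrite /blocks !blocks_cost_cons blocks_cost_cat /net_cost /= !big_cons big_cat /=.
by lra.
Qed.

Lemma blocks_cost0 v wl l wr r :
  blocks_cost (blocks (Node v wl l wr r) 0) =
  wr + (leftmost r).2 + blocks_cost (blocks (Node v wl l wr r) m.+1).
Proof.
by rewrite /blocks !blocks_cost_cons {1}/net_cost /= big_seq1.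
Qed.

(** For each of the [m.+1] shifts, every edge is paid once as a tree edge; every inner node is cut
    for exactly one shift, and then pays for its detour. *)
Lemma sum_blocks_cost b :
  \sum_(j < m.+1) blocks_cost (blocks b j) = m.+1%:R * weight b + detours b.
Proof.
elim: b => [v|v wl l IHl wr r IHr].
  rewrite big1 /= ?mulr0 ?addr0 // => j _.
  by rewrite /blocks /= blocks_cost_cons /net_cost /blocks_cost !big_nil addr0.
(* Shift 0 costs the detour of the root more than shift [m.+1]. After this replacement the shifts
   run from 1 to [m.+1], which at the children become the shifts from 0 to [m]. *)
rewrite big_ord_recl blocks_cost0.
have -> : \sum_(j < m) blocks_cost (blocks (Node v wl l wr r) (lift ord0 j)) =
    \sum_(j < m.+1) blocks_cost (blocks (Node v wl l wr r) j.+1) -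
    blocks_cost (blocks (Node v wl l wr r) m.+1).
  by rewrite big_ord_recr /= addrK; apply: eq_bigr.
under [X in X - _]eq_bigr => j _ do rewrite blocks_costS.
rewrite !big_split IHl IHr !sumr_const card_ord -(mulr_natl wl) -(mulr_natl wr).
move: (m.+1%:R) (blocks_cost (blocks (Node v wl l wr r) m.+1)) => M c /=.
by ring.
Qed.

(** Averaging over the shifts: all detours together cost at most one further copy of the tree. *)
Lemma cheap_blocks b : realized b -> exists2 j, (j <= m)%N &
  m.+1%:R * blocks_cost (blocks b j) <= (m.+2)%:R * weight b.
Proof.
move=> ok; have detour_le : detours b <= weight b.
  apply: le_trans (detours_le b); rewrite lerDl.
  elim: (b) ok => //= v wl l IHl wr r _ [/(near_ge0 G_ge0) wl0 _ /IHl l0 _].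
  exact: addr_ge0.
case: (@Order.TotalTheory.arg_minP _ _ _ (ord0 : 'I_m.+1) predT
  (fun j : 'I_m.+1 => blocks_cost (blocks b j)) isT) => j _ min_j.
exists j; first by rewrite -ltnS.
have : \sum_(i < m.+1) blocks_cost (blocks b j) <=
    \sum_(i < m.+1) blocks_cost (blocks b i).
  by apply: ler_sum => i _; apply: min_j.
rewrite sum_blocks_cost sumr_const card_ord -(mulr_natl (blocks_cost _)).
move=> le1; apply: le_trans le1 _.
by rewrite -[m.+2]addn1 natrD mulrDl mul1r lerD2l.
Qed.

Lemma root_points b h : apex b \in points (top b h).
Proof. by case: b h => [v|v wl l wr r] [|h]; rewrite mem_cat !inE eqxx ?orbT. Qed.

Lemma top_nonempty b h : (top b h).1 != [::].
Proof.
elim: b h => [|v wl l IHl wr r _] [|h] //=.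
by have := IHl h; case: (top l h).1.
Qed.

Lemma leftmost_in b : (leftmost b).1 \in leaves b.
Proof. by elim: b => [v|v wl l IHl wr r _] /=; rewrite ?mem_head // mem_cat IHl. Qed.

Lemma near_leftmost b : realized b -> near G (apex b) (leftmost b).1 (leftmost b).2.
Proof.
elim: b => [v _|v wl l IHl wr r _ /= [near_l _ /IHl near_ll _]]; first exact: near_refl.
exact: near_trans near_ll.
Qed.

Lemma top_leaves b h : {subset (top b h).1 <= leaves b}.
Proof.
elim: b h => [v|v wl l IHl wr r IHr] [|h] q //=.
  by rewrite inE mem_cat => /eqP->; rewrite leftmost_in orbT.
by rewrite !mem_cat => /orP[/IHl->|/IHr->]; rewrite ?orbT.
Qed.

Lemma top_metric b h : realized b -> metric G (top b h).2.
Proof.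
elim: b h => [v|v wl l IHl wr r IHr] [|h] //=.
  move=> [_ near_r _ /near_leftmost near_rl] a c x.
  by rewrite inE => /eqP[-> -> ->]; apply: near_trans near_rl.
move=> [near_l near_r /IHl ml /IHr mr] a c x.
rewrite !inE mem_cat => /or4P[/eqP[-> -> ->]|/eqP[-> -> ->]|/ml|/mr] //.
Qed.

Lemma points_top_split v wl l wr r h x :
  x \in points (top (Node v wl l wr r) h.+1) ->
  [|| x == v, x \in points (top l h) | x \in points (top r h)].
Proof.
rewrite /points /= map_cat flatten_cat !(mem_cat, inE).
have := root_points l h; have := root_points r h; rewrite /points !mem_cat.
move=> hr hl.
case/orP=> [/orP[->|->]|]; rewrite ?orbT //.
case/or3P=> [->|/eqP->|]; rewrite ?hl ?orbT //.
by case/or3P=> [->|/eqP->|/orP[->|->]]; rewrite ?hr ?orbT.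
Qed.

Lemma top_conn b h x : x \in points (top b h) -> conn (link (top b h).2) (apex b) x.
Proof.
elim: b h x => [v|v wl l IHl wr r IHr] [|h] x.
1,2: by rewrite inE => /eqP->.
  rewrite !inE => /or3P[] /eqP-> //; apply: conn1; exists (wr + (leftmost r).2);
    by left; rewrite mem_head.
move=> /points_top_split/or3P[/eqP-> //|/IHl|/IHr] rx.
  apply: (conn_trans (y := apex l)).
    by apply: conn1; exists wl; left; rewrite mem_head.
  apply: conn_sub rx => a c lac; apply: conn1; apply: link_sub lac => e e_in.
  by rewrite /= !inE mem_cat e_in !orbT.
apply: (conn_trans (y := apex r)).
  by apply: conn1; exists wr; left; rewrite /= !inE eqxx orbT.
apply: conn_sub rx => a c lac; apply: conn1; apply: link_sub lac => e e_in.
by rewrite /= !inE mem_cat e_in !orbT.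
Qed.

Lemma top_spans b h : spans (top b h).2 (points (top b h)).
Proof.
move=> x y /top_conn rx /top_conn ry; apply: conn_trans ry.
by apply: conn_sym rx; apply: link_sym.
Qed.

Lemma size_points B : size (points B) = (size B.1 + (size B.2).*2)%N.
Proof.
by rewrite size_cat; congr (_ + _)%N; elim: B.2 => //= g s ->; rewrite doubleS.
Qed.

(** There are at most [2 ^ h] terminals and fewer than [3 * 2 ^ h] edges, and each edge contributes
    two points: hence the factor 1 + 6. *)
Lemma top_size b h : (size (points (top b h)) <= 7 * 2 ^ h)%N.
Proof.
have top1 : (size (top b h).1 <= 2 ^ h)%N.
  elim: b h => [v|v wl l IHl wr r IHr] [|h] //=; first by rewrite expn_gt0.
  by rewrite size_cat expnS mul2n -addnn leq_add.
have top2 : ((size (top b h).2).+2 <= 3 * 2 ^ h)%N.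
  elim: b h {top1} => [v|v wl l IHl wr r IHr] [|h] //=.
    by have := expn_gt0 2 h.+1; lia.
  rewrite size_cat expnS; have := IHl h; have := IHr h; lia.
by rewrite size_points; lia.
Qed.

Lemma top_good b h Q : realized b -> {subset leaves b <= Q} -> (h <= m.+1)%N ->
  good_block (7 * 2 ^ m.+1) Q (top b h).
Proof.
move=> ok sub le_h; split.
- exact: top_nonempty.
- by move=> q /top_leaves/sub.
- exact: top_metric.
- exact: top_spans.
- by apply: leq_trans (top_size b h) _; rewrite leq_mul2l leq_pexp2l.
Qed.

Lemma blocks_good b h Q : realized b -> {subset leaves b <= Q} -> (h <= m.+1)%N ->
  forall B, B \in blocks b h -> good_block (7 * 2 ^ m.+1) Q B.
Proof.
move=> ok sub le_h B; rewrite inE => /predU1P[->|]; first exact: top_good.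
elim: b h ok sub le_h => [v|v wl l IHl wr r IHr] h //= ok sub le_h.
have subl : {subset leaves l <= Q} by move=> q ql; apply: sub; rewrite mem_cat ql.
have subr : {subset leaves r <= Q} by move=> q qr; apply: sub; rewrite mem_cat qr orbT.
have [_ _ okl okr] := ok.
case: h le_h => [|h] le_h.
  rewrite inE => /predU1P[->|]; 
    first exact: (@top_good (Node v wl l wr r) m.+1 Q ok sub (leqnn _)).
  by rewrite mem_cat => /orP[/IHl|/IHr]; apply.
by rewrite mem_cat => /orP[/IHl|/IHr]; apply => //; apply: ltnW.
Qed.

Lemma tlink_sub (bs bs' : seq block) a c :
  {subset bs <= bs'} -> tlink bs a c -> tlink bs' a c.
Proof. by move=> sub [B /sub Bin ac]; exists B. Qed.

(** A component that contains a node above the cut shares a terminal with each of the two subtrees,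
    and so links their leaves. A node at the cut is the root of a component of depth [m.+1], which
    reduces it to the same case. *)
Lemma blocks_conn b h x y : x \in leaves b -> y \in leaves b ->
  conn (tlink (blocks b h)) x y.
Proof.
elim: b h x y => [v|v wl l IHl wr r IHr] h x y.
  by rewrite !inE => /eqP-> /eqP->.
have IHS k : x \in leaves (Node v wl l wr r) -> y \in leaves (Node v wl l wr r) ->
    conn (tlink (top (Node v wl l wr r) k.+1 :: below l k ++ below r k)) x y.
  set bs := _ :: _.
  have sub_l : forall a c, tlink (blocks l k) a c -> tlink bs a c.
    move=> a c [B]; rewrite inE => /predU1P[->|Bin] [ha hc].
      by exists (top (Node v wl l wr r) k.+1); rewrite ?mem_head //= !mem_cat ha hc.
    by exists B => //; rewrite inE mem_cat Bin orbT.
  have sub_r : forall a c, tlink (blocks r k) a c -> tlink bs a c.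
    move=> a c [B]; rewrite inE => /predU1P[->|Bin] [ha hc].
      by exists (top (Node v wl l wr r) k.+1); rewrite ?mem_head //= !mem_cat ha hc !orbT.
    by exists B => //; rewrite inE mem_cat Bin !orbT.
  have conn_l a c : a \in leaves l -> c \in leaves l -> conn (tlink bs) a c.
    by move=> al cl; apply: conn_sub (IHl k _ _ al cl) => ? ? /sub_l; apply: conn1.
  have conn_r a c : a \in leaves r -> c \in leaves r -> conn (tlink bs) a c.
    by move=> al cl; apply: conn_sub (IHr k _ _ al cl) => ? ? /sub_r; apply: conn1.
  have [a al] : exists a, a \in (top l k).1.
    by case: (top l k).1 (top_nonempty l k) => // a s _; exists a; rewrite mem_head.
  have [c cr] : exists c, c \in (top r k).1.
    by case: (top r k).1 (top_nonempty r k) => // c s _; exists c; rewrite mem_head.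
  have ac : conn (tlink bs) a c.
    apply: conn1; exists (top (Node v wl l wr r) k.+1); rewrite ?mem_head //=.
    by rewrite !mem_cat al cr orbT.
  have ca : conn (tlink bs) c a.
    by apply: conn_sym ac => ? ? [B Bin [? ?]]; exists B.
  have al' := top_leaves al; have cr' := top_leaves cr.
  rewrite !mem_cat => /orP[xl|xr] /orP[yl|yr]; auto.
    exact: conn_trans (conn_l _ _ xl al') (conn_trans ac (conn_r _ _ cr' yr)).
  exact: conn_trans (conn_r _ _ xr cr') (conn_trans ca (conn_l _ _ al' yl)).
case: h => [|h] xb yb; last exact: IHS.
apply: conn_sub (IHS m xb yb) => a c ac; apply: conn1.
by apply: tlink_sub ac => B Bin; rewrite /blocks inE Bin orbT.
Qed.

Lemma labels_blocks b h x : x \in labels b ->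
  exists2 B, B \in blocks b h & x \in points B.
Proof.
elim: b h => [v|v wl l IHl wr r IHr] h //.
have IHS k : x \in labels (Node v wl l wr r) ->
    exists2 B, B \in top (Node v wl l wr r) k.+1 :: below l k ++ below r k
      & x \in points B.
  have sub y : y \in points (top l k) \/ y \in points (top r k) ->
      y \in points (top (Node v wl l wr r) k.+1).
    rewrite /points /= map_cat flatten_cat !(mem_cat, inE).
    by case=> /orP[]->; rewrite ?orbT.
  rewrite inE => /predU1P[->|].
    exists (top (Node v wl l wr r) k.+1); rewrite ?mem_head //.
    exact: (root_points (Node v wl l wr r)).
  rewrite mem_cat => /orP[/(IHl k)|/(IHr k)] [B]; rewrite inE => /predU1P[->|Bin] xB.
  - by eexists; [exact: mem_head | apply: sub; left].
  - by exists B; rewrite // inE mem_cat Bin orbT.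
  - by eexists; [exact: mem_head | apply: sub; right].
  - by exists B; rewrite // inE mem_cat Bin !orbT.
case: h => [|h] xb; last exact: IHS.
have [B Bin xB] := IHS m xb; exists B => //.
by rewrite inE Bin orbT.
Qed.

Lemma points_top b h x : x \in points (top b h) ->
  (x \in labels b) || (x \in leaves b).
Proof.
elim: b h => [v|v wl l IHl wr r IHr] [|h].
1,2: by [].
  rewrite !inE mem_cat => /or3P[] /eqP->; rewrite ?eqxx // mem_cat leftmost_in !orbT //.
move=> /points_top_split/or3P[/eqP->|/IHl|/IHr]; rewrite !inE ?eqxx // !mem_cat;
  by case/orP=> ->; rewrite ?orbT.
Qed.

Lemma points_blocks b h B x : B \in blocks b h -> x \in points B ->
  (x \in labels b) || (x \in leaves b).
Proof.
rewrite inE => /predU1P[->|]; first exact: points_top.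
elim: b h => [v|v wl l IHl wr r IHr] h //=.
have IHS h1 h2 : B \in below l h1 ++ below r h2 -> x \in points B ->
    (x \in labels (Node v wl l wr r)) || (x \in leaves (Node v wl l wr r)).
  rewrite mem_cat => /orP[Bin /(IHl _ Bin)|Bin /(IHr _ Bin)];
    by rewrite !(inE, mem_cat) => /orP[]->; rewrite ?orbT.
case: h => [|h]; last exact: IHS.
rewrite inE => /predU1P[->|]; last exact: IHS.
exact: (@points_top (Node v wl l wr r) m.+1).
Qed.

End BinaryTrees.

(** * Exchanging components *)

Section Exchange.

Definition family_link (J : finType) (tm : J -> seq nat) (Y : {set J}) a b :=
  exists2 j, j \in Y & a \in tm j /\ b \in tm j.

Lemma family_link_sym (J : finType) (tm : J -> seq nat) (Y : {set J}) a b :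
  family_link tm Y a b -> family_link tm Y b a.
Proof. by case=> j jY [? ?]; exists j. Qed.

(** [W] represents all classes of [H]. If the class of [w] is not everything, some member of the
    family leaves it; adding that member merges the class with that of another representative, so
    [w] may be dropped. Each representative thus costs at most one member. *)
Lemma augment (J : finType) (tm : J -> seq nat) (Q W : seq nat)
    (H : nat -> nat -> Prop) :
  (forall a b, H a b -> H b a) -> {subset W <= Q} ->
  (forall q, q \in Q -> exists2 w, w \in W & conn H q w) ->
  (forall j, {subset tm j <= Q}) ->
  (forall q q', q \in Q -> q' \in Q -> conn (family_link tm setT) q q') ->
  exists2 Y : {set J}, (#|Y| <= size W)%N & forall q q', q \in Q -> q' \in Q ->
    conn (fun a b => H a b \/ family_link tm Y a b) q q'.
Proof.
move=> + + + tmQ conn_tm; elim: W H => [|w W IHW] H Hsym WQ reps.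
  by exists set0; rewrite ?cards0 // => q q' /reps[].
have [all_w|] := pselect (forall q, q \in Q -> conn H q w).
  exists set0; rewrite ?cards0 // => q q' /all_w qw /all_w q'w.
  have qq' := conn_trans qw (conn_sym Hsym q'w).
  by apply: conn_sub qq' => a b ab; apply: conn1; left.
move=> /existsNP[q /not_implyP[qQ q_nw]].
have wQ : w \in Q by rewrite WQ ?mem_head.
have [a [b [j [aj bj aw b_nw]]]] : exists a b j,
    [/\ a \in tm j, b \in tm j, conn H a w & ~ conn H b w].
  apply: contrapT => none; apply: q_nw.
  apply: (conn_tm w q wQ qQ (fun z => conn H z w)); last exact: conn_refl.
  move=> a b [j _ [aj bj]] aw; apply: contrapT => b_nw.
  by apply: none; exists a, b, j.
pose H' c d := H c d \/ c \in tm j /\ d \in tm j.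
have H'sym c d : H' c d -> H' d c by case=> [/Hsym|[]]; [left|right].
have sub_H c d : conn H c d -> conn H' c d.
  by apply: conn_sub => ? ? h; apply: conn1; left.
have [|q'|Y cardY connY] := IHW H' H'sym.
- by move=> v vW; rewrite WQ // inE vW orbT.
- move=> q'Q; have [v] := reps _ q'Q.
  rewrite inE => /predU1P[->|vW] q'v; last by exists v => //; apply: sub_H.
  have [u] := reps _ (tmQ _ _ bj); rewrite inE => /predU1P[->|uW] bu.
    by case: b_nw.
  exists u => //; apply: conn_trans (sub_H _ _ q'v) _.
  apply: conn_trans (conn_sym H'sym (sub_H _ _ aw)) _.
  by apply: conn_trans (sub_H _ _ bu); apply: conn1; right.
exists (j |: Y).
  by rewrite cardsU1 /=; case: (j \notin Y) => /=; lia.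
move=> q1 q2 q1Q q2Q; apply: conn_sub (connY _ _ q1Q q2Q) => c d cd; apply: conn1.
case: cd => [[h|h]|[i iY h]]; first by left.
  by right; exists j; rewrite ?setU11.
by right; exists i; rewrite // inE iY orbT.
Qed.

(** When [C] is removed, every class still contains a terminal of [C] or a fixed vertex [q0]: on a
    path from [q0], the class changes only through a member of [C]. These at most [K * #|C| + 1]
    representatives are handed to [augment]. *)
Lemma exchange (I J : finType) (tmI : I -> seq nat) (tmJ : J -> seq nat)
    (Q : seq nat) (K : nat) (C : {set I}) :
  Q != [::] ->
  (forall i, {subset tmI i <= Q}) -> (forall j, {subset tmJ j <= Q}) ->
  (forall i, (size (tmI i) <= K)%N) ->
  (forall q q', q \in Q -> q' \in Q -> conn (family_link tmI setT) q q') ->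
  (forall q q', q \in Q -> q' \in Q -> conn (family_link tmJ setT) q q') ->
  exists2 Y : {set J}, (#|Y| <= K * #|C| + 1)%N &
    forall q q', q \in Q -> q' \in Q ->
      conn (fun a b => family_link tmI (~: C) a b \/ family_link tmJ Y a b) q q'.
Proof.
case: Q => // q0 Q _; set Q0 := _ :: _ => tmIQ tmJQ size_tm connI connJ.
have q0Q : q0 \in Q0 := mem_head _ _.
pose W := q0 :: flatten [seq tmI i | i <- enum C].
have [|q|Y cardY connY] :=
  augment (W := W) (@family_link_sym _ tmI (~: C)) _ _ tmJQ connJ.
- by move=> v; rewrite inE => /predU1P[->//|/flatten_mapP[i _ /tmIQ]].
- move=> qQ; apply: (connI q0 q q0Q qQ (fun q => exists2 w, w \in W &
    conn (family_link tmI (~: C)) q w)).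
    move=> a b [i _ [ai bi]] [w wW aw]; have [iC|iC] := boolP (i \in C).
      exists b; last exact: conn_refl.
      by rewrite inE; apply/orP; right; apply/flatten_mapP; exists i; rewrite ?mem_enum.
    exists w => //; apply: conn_trans aw; apply: conn1; exists i => //.
    by rewrite inE.
  by exists q0; [rewrite mem_head | apply: conn_refl].
exists Y => //; apply: leq_trans cardY _; rewrite /W /= addn1 ltnS.
rewrite size_flatten /shape -map_comp cardE.
by elim: (enum C) => //= i s IHs; rewrite mulnS leq_add.
Qed.

(** Here [s] bounds C and [s'] bounds the Y repairing its removal. A round adds to C a repair of the
    removal of Y, at most [K * s' + 1] members. *)
Fixpoint swap_bound (K n s : nat) : nat :=
  let s' := (K * s + 1)%N in
  if n is n'.+1 then swap_bound K n' (s + (K * s' + 1))%N else (s + s')%N.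

Lemma swap_bound_ge K n s : (s + (K * s + 1) <= swap_bound K n s)%N.
Proof.
elim: n s => //= n IHn s; apply: leq_trans (IHn _).
by rewrite mulnDr; lia.
Qed.

Section Descent.
Variables (R : realType) (I J : finType).
Variables (tmI : I -> seq nat) (tmJ : J -> seq nat).
Variables (cI : I -> R) (cJ : J -> R) (Q : seq nat) (K : nat) (i0 : I) (w0 : R).
Hypothesis Q0 : Q != [::].
Hypothesis tmIQ : forall i, {subset tmI i <= Q}.
Hypothesis tmJQ : forall j, {subset tmJ j <= Q}.
Hypothesis size_tmI : forall i, (size (tmI i) <= K)%N.
Hypothesis size_tmJ : forall j, (size (tmJ j) <= K)%N.
Hypothesis connI : forall q q', q \in Q -> q' \in Q ->
  conn (family_link tmI setT) q q'.
Hypothesis connJ : forall q q', q \in Q -> q' \in Q ->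
  conn (family_link tmJ setT) q q'.
Hypothesis cI_ge0 : forall i, 0 <= cI i.
Hypothesis opt : forall (C : {set I}) (D : {set J}), i0 \in C ->
  (forall q q', q \in Q -> q' \in Q ->
     conn (fun a b => family_link tmJ (~: D) a b \/ family_link tmI C a b) q q') ->
  w0 <= \sum_(j in ~: D) cJ j + \sum_(i in C) cI i.

(* If exchanging [C] for [Y] is not good enough, then the components needed to
   repair [J] without [Y] cost more than [theta]; add them to [C]. *)
Lemma descent theta n (C : {set I}) s : i0 \in C -> (#|C| <= s)%N -> 0 <= theta ->
  \sum_(i in ~: C) cI i <= n%:R * theta ->
  exists (C' : {set I}) (Y : {set J}), [/\ i0 \in C',
    (#|C'| + #|Y| <= swap_bound K n s)%N,
    forall q q', q \in Q -> q' \in Q ->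
      conn (fun a b => family_link tmI (~: C') a b \/ family_link tmJ Y a b) q q'
    & \sum_(i in ~: C') cI i + \sum_(j in Y) cJ j <=
      (\sum_i cI i - w0) + \sum_j cJ j + theta].
Proof.
elim: n C s => [|n IHn] C s iC card_C theta_ge0 le_C.
all: have [Y card_Y conn_Y] := exchange C Q0 tmIQ tmJQ size_tmI connI connJ.
all: have [D card_D conn_D] := exchange Y Q0 tmJQ tmIQ size_tmJ connJ connI.
all: have splitI (E : {set I}) :
  \sum_i cI i = \sum_(i in E) cI i + \sum_(i in ~: E) cI i
  by rewrite (bigID (mem E)) /=; congr (_ + _); apply: eq_bigl => i; rewrite inE.
all: have splitJ (E : {set J}) :
  \sum_j cJ j = \sum_(j in E) cJ j + \sum_(j in ~: E) cJ j
  by rewrite (bigID (mem E)) /=; congr (_ + _); apply: eq_bigl => j; rewrite inE.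
all: have iCD : i0 \in C :|: D by rewrite inE iC.
all: have le_opt : w0 <= \sum_(j in ~: Y) cJ j + \sum_(i in C :|: D) cI i.
1,3: apply: opt => // q q' qQ q'Q;
  apply: conn_sub (conn_D _ _ qQ q'Q) => a b [h|[i iD h]];
  apply: conn1; [by left | by right; exists i; rewrite // inE iD orbT].
all: have card_CY : (#|C| + #|Y| <= s + (K * s + 1))%N by
  apply: leq_add => //; apply: leq_trans card_Y _;
  rewrite leq_add2r leq_mul2l card_C orbT.
all: have CD_ge0 : 0 <= \sum_(i in ~: (C :|: D)) cI i by apply: sumr_ge0.
all: have := splitI C; have := splitI (C :|: D); have := splitJ Y.
  (* Now the complement of [C] costs nothing, and hence neither does adding [D] to [C]. *)
  rewrite mul0r in le_C => *; exists C, Y; split=> //; lra.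
(* The difference is the cost of what [D] adds to [C]. By [le_opt], exchanging [C] for [Y] exceeds
   the bound without [theta] by at most this difference. If it is more than [theta], then the
   complement of [C :|: D] is cheaper by more than [theta], which pays for the round. *)
have [le_theta|gt_theta] :=
  lerP (\sum_(i in ~: C) cI i - \sum_(i in ~: (C :|: D)) cI i) theta.
  move=> *; exists C, Y; split=> //; last lra.
  exact: leq_trans card_CY (swap_bound_ge _ n.+1 _).
move=> *; apply: (IHn (C :|: D)) => //;
  last by rewrite -natr1 mulrDl mul1r in le_C; lra.
apply: leq_trans (leq_card_setU _ _) _; apply: leq_add => //.
apply: leq_trans card_D _; rewrite leq_add2r leq_mul2l; apply/orP; right.
by apply: leq_trans card_Y _; rewrite leq_add2r leq_mul2l card_C orbT.
Qed.

End Descent.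
End Exchange.

Lemma mem_lists m (V D : seq nat) : (size D <= m)%N -> {subset D <= V} ->
  D \in lists m V.
Proof.
elim: m D => [|m IHm] [|v D] //= le_D sub.
rewrite inE /=; apply/flatten_mapP; exists v; first by rewrite sub ?mem_head.
by apply: map_f; apply: IHm => // x xD; rewrite sub // inE xD orbT.
Qed.

Lemma size_flatten_le (X Y : eqType) (f : X -> seq Y) K (s : seq X) :
  (forall x, x \in s -> (size (f x) <= K)%N) ->
  (size (flatten [seq f x | x <- s]) <= K * size s)%N.
Proof.
elim: s => //= x s IHs le_K; rewrite size_cat mulnS leq_add ?le_K ?mem_head //.
by apply: IHs => y ys; rewrite le_K // inE ys orbT.
Qed.

(** * From components back to networks, and the bounded swap *)

Section Swap.
Variables (R : realType).

Definition net_of (bs : seq (block R)) : seq (edge R) :=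
  flatten [seq B.2 | B <- bs].

Definition points_of (bs : seq (block R)) : seq nat :=
  flatten [seq points B | B <- bs].

Lemma net_cost_of bs : net_cost (net_of bs) = blocks_cost bs.
Proof.
by elim: bs => [|B bs IH]; rewrite /net_cost /blocks_cost ?big_nil // big_cons
  -/(blocks_cost bs) -IH /net_of /= big_cat.
Qed.

Lemma spans_cons (N : seq (edge R)) Z t u w : spans N Z -> u \in Z ->
  spans (((t, u), w) :: N) (t :: Z).
Proof.
move=> spanN uZ.
have to_u x : x \in t :: Z -> conn (link (((t, u), w) :: N)) x u.
  rewrite inE => /predU1P[->|xZ].
    by apply: conn1; exists w; left; rewrite mem_head.
  apply: conn_sub (spanN _ _ xZ uZ) => a b ab; apply: conn1.
  by apply: link_sub ab => e e_in; rewrite inE e_in orbT.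
move=> x y /to_u xu /to_u yu; apply: conn_trans xu _.
by apply: conn_sym yu; apply: link_sym.
Qed.

Variables (G : seq (edge R)) (V : seq nat).
Hypothesis G_ge0 : forall g : edge R, g \in G -> 0 <= g.2.
Hypothesis G_in : forall (a b : nat) (x : R), ((a, b), x) \in G -> b \in V.

Lemma net_of_spans K Q bs : Q != [::] ->
  (forall B, B \in bs -> good_block G K Q B) ->
  (forall q q', q \in Q -> q' \in Q -> conn (tlink bs) q q') ->
  [/\ metric G (net_of bs), within (net_of bs) (Q ++ points_of bs) &
      spans (net_of bs) (Q ++ points_of bs)].
Proof.
move=> Q0 good connQ; split.
- move=> a b x /flatten_mapP[B /good[_ _ metB _ _]]; exact: metB.
- move=> a b x /flatten_mapP[B Bin /mem_points_edge/andP[ha hb]].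
  by rewrite !mem_cat; split; apply/orP; right; apply/flatten_mapP; exists B.
have in_block B x y : B \in bs -> x \in points B -> y \in points B ->
    conn (link (net_of bs)) x y.
  move=> Bin xB yB; have [_ _ _ spanB _] := good _ Bin.
  apply: conn_sub (spanB _ _ xB yB) => a b ab; apply: conn1.
  by apply: link_sub ab => e e_in; apply/flatten_mapP; exists B.
have [q0 q0Q] : exists q, q \in Q by case: (Q) Q0 => // q s; exists q; rewrite mem_head.
have to_q0 x : x \in Q ++ points_of bs -> conn (link (net_of bs)) x q0.
  have Q_q0 q : q \in Q -> conn (link (net_of bs)) q q0.
    move=> qQ; apply: conn_sub (connQ _ _ qQ q0Q) => a b [B Bin [aB bB]].
    by apply: (in_block B) => //; rewrite mem_cat ?aB ?bB.
  rewrite mem_cat => /orP[/Q_q0//|/flatten_mapP[B Bin xB]].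
  have [B0 subB _ _ _] := good _ Bin.
  have [q qB] : exists q, q \in B.1.
    by case: (B.1) B0 => // q s; exists q; rewrite mem_head.
  apply: conn_trans (Q_q0 q (subB _ qB)); apply: (in_block B) => //.
  by rewrite mem_cat qB.
move=> x y /to_q0 xq /to_q0 yq; apply: conn_trans xq _.
by apply: conn_sym yq; apply: link_sym.
Qed.

Lemma leftmost_le b : realized G b -> (leftmost b).2 <= weight b.
Proof.
elim: b => //= v wl l IHl wr r _.
move=> [_ /(near_ge0 G_ge0) wr0 /IHl le_l /(weight_ge0 G_ge0) r0].
by lra.
Qed.

Lemma walk_in a b w : walk G a b w -> a \in V -> b \in V.
Proof. by elim=> // {}b c {}w x _ _ Gx _; apply: G_in Gx. Qed.

Lemma labels_in b : realized G b -> apex b \in V -> {subset labels b <= V}.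
Proof.
elim: b => //= v wl l IHl wr r IHr [[w1 _ walk1] [w2 _ walk2] okl okr] vV q.
rewrite inE mem_cat => /or3P[/eqP->//|/IHl|/IHr]; apply => //.
  exact: walk_in walk1 vV.
exact: walk_in walk2 vV.
Qed.

Lemma grown_btree r VT ET k Q : grown G r VT ET k -> Q != [::] ->
  {subset Q <= VT} -> exists w b, [/\ near G r (apex b) w, realized G b,
    w + weight b <= k, leaves b =i Q & labels b =i branching Q ET].
Proof.
move=> gr Q0 QVT.
(* Initially every vertex of [Q] is a leaf at distance zero from itself. An inner vertex in [Q]
   thereby becomes a node as soon as a subtree meeting [Q] is attached to it. *)
pose F v : option (R * btree R) := if v \in Q then Some (0, Leaf R v) else None.
have [|||||w [b [h1 h2 h3 h4 h5]]] :=
  extract_btree G_ge0 gr (F := F) (alive := Q) (Q := Q) (L := [::]).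
- by move=> v _; rewrite /F; case: ifP.
- by move=> v p _; rewrite /F; case: ifP => // _ [<-]; split=> //; apply: near_refl.
- by case: (Q) Q0 QVT => // q s _ sub; exists q; rewrite ?sub ?mem_head.
- move=> q; split=> [qQ|[v _]].
    by exists q; [apply: QVT | rewrite /F qQ /= mem_head].
  by rewrite /F; case: ifP => //= vQ; rewrite inE => /eqP->.
- by move=> q; split=> // -[v _]; rewrite /F; case: ifP.
exists w, b; split=> //; apply: le_trans h3 _.
rewrite big1 ?addr0 // => v _; rewrite /F; case: ifP => //= _.
by rewrite addr0.
Qed.

Lemma btree_blocks b Q m : realized G b -> leaves b =i Q ->
  exists bs, [/\ forall B, B \in bs -> good_block G (7 * 2 ^ m.+1) Q B,
    forall q q', q \in Q -> q' \in Q -> conn (tlink bs) q q',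
    m.+1%:R * blocks_cost bs <= m.+2%:R * weight b,
    exists B0 bs', bs = B0 :: bs' /\ apex b \in points B0 &
    (forall x, x \in labels b -> x \in points_of bs) /\
    (forall B x, B \in bs -> x \in points B -> (x \in labels b) || (x \in Q))].
Proof.
move=> ok leavesQ; have [j le_j cost_j] := cheap_blocks G_ge0 m ok.
exists (blocks m b j); split=> //.
- by apply: blocks_good => //; [move=> q; rewrite leavesQ | apply: ltnW].
- by move=> q q'; rewrite -!leavesQ; apply: blocks_conn.
- by exists (top b j), (below m b j); split=> //; apply: root_points.
split=> [x /(labels_blocks m j)[B Bin xB]|B x Bin xB].
  by apply/flatten_mapP; exists B.
by rewrite -leavesQ; apply: points_blocks Bin xB.
Qed.

End Swap.

(** [M] is chosen before the graph, which makes the enumeration of [lists M V] polynomial. The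
    optimality of the old tree is assumed in terms of networks, so that any mixture of old and new
    components can be tested against it. *)
Lemma swap_exists (R : realType) (eps : R) : 0 < eps -> exists M : nat,
  forall (G : seq (edge R)) (V : seq nat),
  (forall g : edge R, g \in G -> 0 <= g.2) ->
  (forall (a b : nat) (x : R), ((a, b), x) \in G -> b \in V) ->
  uniq V -> forall t Q VT0 ET0 k0 r1 VT1 ET1 k1,
  t \in V -> Q != [::] -> {subset Q <= V} ->
  grown G t VT0 ET0 k0 -> {subset Q <= VT0} ->
  grown G r1 VT1 ET1 k1 -> {subset Q <= VT1} -> r1 \in V ->
  (forall N Z, metric G N -> within N Z -> spans N Z -> t \in Z ->
     {subset Q <= Z} -> {subset Z <= V} -> k0 <= net_cost N) ->
  exists D N, let Z := swap V Q (branching Q ET0) D in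
    [/\ D \in lists M V, metric G N, within N Z, spans N Z &
        net_cost N <= (1 + eps) * k1].
Proof.
move=> eps_gt0.
(* The same [m] governs the depth of the components and the number of rounds. The components of the
   old tree will cost at most [8 * k1], to be exhausted in rounds of [eps / 2 * k1], and the
   decompositions will lose at most [5 * k1 / (m + 1)]; both fit. *)
have [m m_eps] : exists m : nat, 20 <= m%:R * eps.
  exists (Num.bound (20 / eps)); rewrite -ler_pdivrMr //; apply: ltW.
  by apply: archi_boundP; rewrite divr_ge0 // ltW.
pose K := (7 * 2 ^ m.+1)%N.
exists (K * swap_bound K m 1)%N.
move=> G V G_ge0 G_in uniqV t Q VT0 ET0 k0 r1 VT1 ET1 k1.
move=> tV Q0 QV gr0 Q0T gr1 Q1T r1V opt.
have [w [b [near_b ok_b le_k0 leaves_b labels_b]]] := grown_btree G_ge0 gr0 Q0 Q0T.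
have [w' [b' [near_b' ok_b' le_k1 leaves_b' _]]] := grown_btree G_ge0 gr1 Q0 Q1T.
have [bs [good conn_bs cost_bs [B0 [bs0 [def_bs root_b]]] [sub_bs bs_sub]]] :=
  btree_blocks G_ge0 m ok_b leaves_b.
have [bs' [good' conn_bs' cost_bs' _ [_ bs'_sub]]] :=
  btree_blocks G_ge0 m ok_b' leaves_b'.
have w_ge0 := near_ge0 G_ge0 near_b; have w'_ge0 := near_ge0 G_ge0 near_b'.
have rootV : apex b \in V by case: near_b => ? _ /(walk_in G_in); apply.
have rootV' : apex b' \in V by case: near_b' => ? _ /(walk_in G_in); apply.
have pointsV B x : B \in bs -> x \in points B -> x \in V.
  by move=> Bin /(bs_sub _ _ Bin)/orP[/(labels_in G_in ok_b rootV)|/QV].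
have pointsV' B x : B \in bs' -> x \in points B -> x \in V.
  by move=> Bin /(bs'_sub _ _ Bin)/orP[/(labels_in G_in ok_b' rootV')|/QV].
(* Any network of components becomes feasible for the old instance once [t] is
   attached to it. *)
have opt_net bs1 u x : (forall B, B \in bs1 -> good_block G K Q B) ->
    (forall B y, B \in bs1 -> y \in points B -> y \in V) ->
    (forall q q', q \in Q -> q' \in Q -> conn (tlink bs1) q q') ->
    near G t u x -> u \in Q ++ points_of bs1 -> k0 <= x + blocks_cost bs1.
  move=> good1 in1 conn1 near_u u_in.
  have [met1 within1 spans1] := net_of_spans Q0 good1 conn1.
  have -> : x + blocks_cost bs1 = net_cost (((t, u), x) :: net_of bs1).
    by rewrite /net_cost big_cons -/(net_cost _) net_cost_of.
  apply: (opt _ (t :: Q ++ points_of bs1)).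
  - by move=> a c y; rewrite inE => /predU1P[[-> -> ->]|/met1].
  - move=> a c y; rewrite !inE => /predU1P[[-> -> _]|/within1[-> ->]].
      by rewrite eqxx u_in orbT.
    by rewrite !orbT.
  - exact: spans_cons.
  - exact: mem_head.
  - by move=> q qQ; rewrite inE mem_cat qQ orbT.
  - move=> y; rewrite inE => /predU1P[->//|]; rewrite mem_cat => /orP[/QV//|].
    by case/flatten_mapP=> B /in1; apply.
have wb_ge0 := weight_ge0 G_ge0 ok_b; have wb'_ge0 := weight_ge0 G_ge0 ok_b'.
have in_Q q : q \in leaves b -> q \in Q ++ points_of bs'.
  by rewrite leaves_b mem_cat => ->.
(* The cut path, one leg from the apex to a leaf of [l], and the new components are feasible for the
   old instance. As the leg costs at most [wl + weight l], the other side [wr + weight r] costs at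
   most [blocks_cost bs']. The same holds with the sides interchanged. *)
have wb_le : weight b <= 2 * blocks_cost bs'.
  have c'_ge0 : 0 <= blocks_cost bs'.
    rewrite /blocks_cost big_seq; apply: sumr_ge0 => B /good'[_ _ metB _ _].
    exact: net_cost_ge0 metB.
  case: (b) near_b ok_b le_k0 in_Q => [v|v wl l wr r] near_u ok le1 in_Q1 /=.
    by rewrite mulr_ge0.
  have [near_l near_r okl okr] := ok.
  have k0_l : k0 <= w + (wl + (leftmost l).2) + blocks_cost bs'.
    apply: (opt_net _ (leftmost l).1) => //.
      apply: near_trans near_u _; apply: near_trans near_l _; exact: near_leftmost.
    by apply: in_Q1; rewrite mem_cat leftmost_in.
  have k0_r : k0 <= w + (wr + (leftmost r).2) + blocks_cost bs'.
    apply: (opt_net _ (leftmost r).1) => //.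
      apply: near_trans near_u _; apply: near_trans near_r _; exact: near_leftmost.
    by apply: in_Q1; rewrite mem_cat leftmost_in orbT.
  have := leftmost_le G_ge0 okl; have := leftmost_le G_ge0 okr.
  by rewrite /= in le1; lra.
have k1_ge0 : 0 <= k1 by lra.
have theta_ge0 : 0 <= eps / 2 * k1 by apply: mulr_ge0 => //; lra.
have mu_ge0 : 0 <= m%:R :> R by apply: ler0n.
have mu1_gt0 : 0 < m%:R + 1 :> R by lra.
have le20 : 20 * k1 <= m%:R * eps * k1 by apply: ler_wpM2r.
rewrite -[m.+2]addn2 -[m.+1]addn1 !natrD in cost_bs cost_bs'.
have c_le : blocks_cost bs <= 2 * weight b.
  have : 0 <= m%:R * weight b by apply: mulr_ge0.
  by rewrite -(ler_pM2l mu1_gt0); nra.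
have c'_le : blocks_cost bs' <= 2 * weight b'.
  have : 0 <= m%:R * weight b' by apply: mulr_ge0.
  by rewrite -(ler_pM2l mu1_gt0); nra.
pose Bdef : block R := ([::], [::]).
pose I := 'I_(size bs); pose J := 'I_(size bs').
pose BI (i : I) := nth Bdef bs i; pose BJ (j : J) := nth Bdef bs' j.
have BI_in i : BI i \in bs by apply: mem_nth.
have BJ_in j : BJ j \in bs' by apply: mem_nth.
have i0P : (0 < size bs)%N by rewrite def_bs.
pose i0 : I := Ordinal i0P.
have conn_fam (L : finType) (BL : L -> block R) (bl : seq (block R)) :
    (forall B, B \in bl -> exists i, BL i = B) ->
    (forall q q', q \in Q -> q' \in Q -> conn (tlink bl) q q') ->
    forall q q', q \in Q -> q' \in Q ->
      conn (family_link (fun i => (BL i).1) setT) q q'.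
  move=> BLP connl q q' qQ q'Q; apply: conn_sub (connl _ _ qQ q'Q) => x y.
  by move=> [B /BLP[i <-] xy]; apply: conn1; exists i.
have connI := conn_fam I BI bs _ conn_bs.
have connJ := conn_fam J BJ bs' _ conn_bs'.
have {}connI : forall q q', q \in Q -> q' \in Q ->
    conn (family_link (fun i => (BI i).1) setT) q q'.
  by apply: connI => B /(nthP Bdef)[i lt_i <-]; exists (Ordinal lt_i).
have {}connJ : forall q q', q \in Q -> q' \in Q ->
    conn (family_link (fun j => (BJ j).1) setT) q q'.
  by apply: connJ => B /(nthP Bdef)[i lt_i <-]; exists (Ordinal lt_i).
have tm_sub B : good_block G K Q B -> {subset B.1 <= Q} by case.
have tm_size B : good_block G K Q B -> (size B.1 <= K)%N.
  by case=> _ _ _ _; rewrite size_cat; apply: leq_trans (leq_addr _ _).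
have cost_ge0 B : good_block G K Q B -> 0 <= net_cost B.2.
  by case=> _ _ metB _ _; apply: net_cost_ge0 metB.
have costI : \sum_i net_cost (BI i).2 = blocks_cost bs.
  by rewrite /blocks_cost (big_nth Bdef) big_mkord.
have costJ : \sum_j net_cost (BJ j).2 = blocks_cost bs'.
  by rewrite /blocks_cost (big_nth Bdef) big_mkord.
pose mix (C : {set I}) (D : {set J}) : seq (block R) :=
  [seq BI i | i <- enum C] ++ [seq BJ j | j <- enum D].
have mix_in C D B : B \in mix C D -> B \in bs \/ B \in bs'.
  by rewrite mem_cat => /orP[] /mapP[i _ ->]; auto.
have mix_good C D B : B \in mix C D -> good_block G K Q B.
  by case/mix_in => [/good|/good'].
have mix_cost C D : blocks_cost (mix C D) =
    \sum_(i in C) net_cost (BI i).2 + \sum_(j in D) net_cost (BJ j).2.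
  by rewrite /blocks_cost big_cat !big_map /= !big_enum.
have mix_conn C D q q' :
    conn (fun x y => family_link (fun i => (BI i).1) C x y
                  \/ family_link (fun j => (BJ j).1) D x y) q q' ->
    conn (tlink (mix C D)) q q'.
  apply: conn_sub => x y [] [i iC xy]; apply: conn1.
    by exists (BI i); rewrite // mem_cat map_f ?mem_enum.
  by exists (BJ i); rewrite // mem_cat [X in _ || X]map_f ?mem_enum ?orbT.
have [||||||||||C [Y [i0C card_CY conn_CY cost_CY]]] := @descent R I J
  (fun i => (BI i).1) (fun j => (BJ j).1) (fun i => net_cost (BI i).2)
  (fun j => net_cost (BJ j).2) Q K i0 (weight b) Q0 _ _ _ _ connI connJ _ _
  (eps / 2 * k1) m [set i0] 1.
- by move=> i; apply/tm_sub/good.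
- by move=> j; apply/tm_sub/good'.
- by move=> i; apply/tm_size/good.
- by move=> j; apply/tm_size/good'.
- by move=> i; apply/cost_ge0/good.
- move=> C D iC conn_CD.
  suff : k0 <= w + blocks_cost (mix C (~: D)) by rewrite mix_cost; lra.
  apply: (opt_net _ (apex b)) => //.
  + exact: mix_good.
  + by move=> B y /mix_in[/pointsV|/pointsV']; apply.
  + move=> q q' qQ q'Q; apply: mix_conn; apply: conn_sub (conn_CD _ _ qQ q'Q).
    by move=> x y [h|h]; apply: conn1; [right|left].
  + rewrite mem_cat; apply/orP; right; apply/flatten_mapP; exists (BI i0).
      by rewrite mem_cat map_f ?mem_enum.
    by rewrite /BI /= def_bs.
- by rewrite inE.
- by rewrite cards1.
- exact: theta_ge0.
(* The chain through [c_le], [wb_le] and [c'_le] gives [8 * k1], while [m] rounds allow for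
   [10 * k1]. *)
- apply: le_trans (_ : blocks_cost bs <= _); last by move: le20; lra.
  rewrite -costI [leRHS](bigID (mem [set i0])) /= addrC.
  have -> : \sum_(i in ~: [set i0]) net_cost (BI i).2 =
      \sum_(i | i \notin [set i0]) net_cost (BI i).2.
    by apply: eq_bigl => i; rewrite in_setC.
  by rewrite lerDl sumr_ge0 // => i _; apply/cost_ge0/good.
have [metN withinN spansN] := net_of_spans Q0 (@mix_good (~: C) Y)
  (fun q q' qQ q'Q => mix_conn _ _ _ _ (conn_CY q q' qQ q'Q)).
pose L := branching Q ET0.
(* Outside [Q], this is the symmetric difference of the branching vertices and the points of the new
   network, so that [swap] restores exactly those points. *)
pose D := [seq v <- V |
  (v \notin Q) && ((v \in L) (+) (v \in points_of (mix (~: C) Y)))].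
exists D, (net_of (mix (~: C) Y)).
have swapE : swap V Q L D =i Q ++ points_of (mix (~: C) Y).
  move=> v; rewrite mem_filter mem_cat mem_filter.
  have [vQ|vQ] := boolP (v \in Q); first by rewrite /= QV.
  have [vV|vV] := boolP (v \in V); rewrite ?andbT ?andbF /=.
    by rewrite addbA addbb.
  apply/esym/negbTE; apply: contra vV => /flatten_mapP[B].
  by move=> /mix_in[/pointsV|/pointsV']; apply.
split.
- apply: mem_lists; last by move=> v; rewrite mem_filter => /andP[].
  apply: leq_trans (_ : K * (#|C| + #|Y|) <= _)%N; last exact: leq_mul.
  pose pts := flatten [seq points (BI i) | i <- enum C] ++
              flatten [seq points (BJ j) | j <- enum Y].
  apply: leq_trans (_ : size pts <= _)%N; last first.
    rewrite size_cat mulnDr !cardE; apply: leq_add; apply: size_flatten_le.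
      by move=> i _; have [] := good _ (BI_in i).
    by move=> j _; have [] := good' _ (BJ_in j).
  apply: uniq_leq_size => [|v]; first exact: filter_uniq.
  rewrite mem_filter => /andP[/andP[vQ]].
  (* A branching vertex missing from the network is a point of a removed component, in [C]. A point
     of the network that is not a branching vertex comes from [Y], since outside [Q] the old
     components have only branching vertices as points. *)
  have [vL|vL] := boolP (v \in L); rewrite /= => v_pts vV; rewrite mem_cat; apply/orP.
    have : v \in labels b by rewrite labels_b.
    move=> /sub_bs/flatten_mapP[B /(nthP Bdef)[i lt_i <-] vB].
    left; apply/flatten_mapP; exists (Ordinal lt_i) => //; rewrite mem_enum.
    apply: contraNT v_pts => iC; apply/flatten_mapP; exists (BI (Ordinal lt_i)) => //.
    by rewrite mem_cat map_f // mem_enum inE.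
  case/flatten_mapP: v_pts => B; rewrite mem_cat => /orP[] /mapP[i iC ->] vB; last first.
    by right; apply/flatten_mapP; exists i.
  have := bs_sub _ _ (BI_in i) vB; rewrite labels_b (negPf vQ) orbF => vL'.
  by rewrite vL' in vL.
- exact: metN.
- by move=> a c x /withinN; rewrite !swapE.
- by move=> x y; rewrite !swapE; apply: spansN.
rewrite net_cost_of mix_cost; apply: le_trans cost_CY _; rewrite costI costJ.
(* Multiplied by [m + 1], the first loss is at most [weight b], hence at most [4 * k1], and the
   second at most [k1]. *)
suff : blocks_cost bs - weight b + (blocks_cost bs' - k1) <= eps / 2 * k1 by lra.
have : (m%:R + 1 + 1) * (weight b' - k1) <= 0 by apply: mulr_ge0_le0; lra.
by rewrite -(ler_pM2l mu1_gt0); nra.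
Qed.

(** * From lists to graphs *)

Section Subtrees.
Variable n : nat.
Implicit Types (F E : {set {set 'I_n}}) (S : subgraph n).

Lemma set2_eq (T : finType) (a b i j : T) :
  ([set a; b] == [set i; j]) = (a == i) && (b == j) || (a == j) && (b == i).
Proof.
apply/eqP/orP => [eq_ab|[]/andP[/eqP-> /eqP->]]; [|by []|exact: setUC].
have: a \in [set i; j] by rewrite -eq_ab !inE eqxx.
have: b \in [set i; j] by rewrite -eq_ab !inE eqxx orbT.
have: i \in [set a; b] by rewrite eq_ab !inE eqxx.
have: j \in [set a; b] by rewrite eq_ab !inE eqxx orbT.
rewrite !inE (eq_sym i a) (eq_sym i b) (eq_sym j a) (eq_sym j b).
by case: (a == i) (a == j) (b == i) (b == j) => [] [] [] []; auto.
Qed.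

Lemma adj_sym E : symmetric (adj E).
Proof. by move=> x y; rewrite /adj setUC. Qed.

Lemma subtree1 E v : subtree E (Subgraph [set v] set0).
Proof.
split=> /=.
- by apply/set0Pn; exists v; rewrite inE.
- exact: sub0set.
- by move=> e; rewrite inE.
- by move=> x y; rewrite !inE => /eqP-> /eqP->; apply: connect0.
case=> [|x [|y p]] // _ /andP[/= /andP[]].
by rewrite /adj inE.
Qed.

Lemma subtree_leaf E S u v : subtree E S -> u \in sverts S -> v \notin sverts S ->
  [set u; v] \in E ->
  subtree E (Subgraph (v |: sverts S) ([set u; v] |: sedges S)).
Proof.
case: S => VS ES [/= VS0 ESE ES_VS conS acS] uV v_nin uvE.
have v_ne_u : v != u by apply: contraNneq v_nin => ->.
split=> /=.
- by apply/set0Pn; exists v; rewrite setU11.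
- by rewrite subUset sub1set uvE.
- move=> e; rewrite inE => /orP[|/ES_VS sub]; last exact: subset_trans sub (subsetUr _ _).
  rewrite inE => /eqP->; apply/subsetP => x; rewrite !inE => /orP[]/eqP->.
    by rewrite uV orbT.
  by rewrite eqxx.
- have to_u x : x \in v |: VS -> connect (adj ([set u; v] |: ES)) x u.
    rewrite inE => /orP[|xV].
      by rewrite inE => /eqP->; apply: connect1; rewrite /adj setUC setU11.
    apply: connect_sub (conS _ _ xV uV) => a b ab; apply: connect1.
    by rewrite /adj inE -/(adj ES a b) ab orbT.
  move=> x y /to_u xu /to_u; rewrite (sym_connect_sym (adj_sym _)).
  exact: connect_trans.
(* The only neighbour of the new vertex is [u], so a cycle through [v] would have to visit [u]
   twice. *)
have adj_v y : adj ([set u; v] |: ES) v y -> y = u.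
  rewrite /adj !inE set2_eq (negPf v_ne_u) /=.
  move=> /orP[/andP[_ /eqP]//|/ES_VS/subsetP/(_ v)].
  by rewrite !inE eqxx (negPf v_nin) => /(_ isT).
move=> p size_p cyc_p; have [vp|vp] := boolP (v \in p).
  case: (rot_to vp) => i p' def_p.
  have : ucycle (adj ([set u; v] |: ES)) (v :: p') by rewrite -def_p rot_ucycle.
  have : (2 < size (v :: p'))%N by rewrite -def_p size_rot.
  case: p' {def_p} => [|y p'] //= size_p' /andP[/= /andP[/adj_v-> ]].
  rewrite rcons_path => /andP[_]; rewrite adj_sym => /adj_v last_u.
  case: p' size_p' last_u => [|z p'] //= _ last_u.
  by move=> /and3P[_ /negP[]]; rewrite -{1}last_u mem_last.
apply: (acS p size_p); case/andP: cyc_p => cyc uniq_p; rewrite /ucycle uniq_p andbT.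
apply: sub_in_cycle (_ : all (mem p) p) cyc; last by apply/allP.
move=> x y xp yp; rewrite /adj inE => /orP[|//].
rewrite inE set2_eq => /orP[]/andP[/eqP ? /eqP ?]; subst;
  by [rewrite yp in vp|rewrite xp in vp].
Qed.

Lemma mem_edge_pairs F p :
  (p \in edge_pairs F) = (p.1 < p.2)%N && adj F p.1 p.2.
Proof.
rewrite mem_filter andb_idr // => _; case: p => i j.
by apply/allpairsP; exists (i, j); rewrite !mem_enum.
Qed.

Lemma uniq_edge_pairs F : uniq (edge_pairs F).
Proof.
apply/filter_uniq/allpairs_uniq; rewrite ?enum_uniq //.
by move=> [? ?] [? ?] _ _ [-> ->].
Qed.

Lemma adj_edge_pairs F i j : simple_graph F -> adj F i j ->
  (i, j) \in edge_pairs F \/ (j, i) \in edge_pairs F.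
Proof.
move=> simpF ij; rewrite !mem_edge_pairs /= (adj_sym _ j) ij !andbT.
have := simpF _ ij; rewrite cards2; case: eqVneq => // ij_ne _.
by apply/orP; rewrite -neq_ltn; apply: contraNneq ij_ne => /val_inj->.
Qed.

Lemma sum_edge_pairs (R : realType) F (c : {set 'I_n} -> R) : simple_graph F ->
  \sum_(p <- edge_pairs F) c [set p.1; p.2] = \sum_(e in F) c e.
Proof.
move=> simpF; rewrite -(big_map (fun p : 'I_n * 'I_n => [set p.1; p.2]) predT c).
rewrite -[RHS]big_enum; apply: perm_big; apply: uniq_perm.
- rewrite map_inj_in_uniq ?uniq_edge_pairs // => -[i j] [k l].
  rewrite !mem_edge_pairs /= => /andP[ij _] /andP[kl _] /eqP.
  rewrite set2_eq => /orP[]/andP[/eqP ? /eqP ?]; subst => //.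
  by have := ltn_trans ij kl; rewrite ltnn.
- exact: enum_uniq.
move=> e; rewrite mem_enum; apply/mapP/idP => [[p]|eF].
  by rewrite mem_edge_pairs => /andP[_ pF] ->.
have /eqP/cards2P[x [y [_ def_e]]] := simpF _ eF.
have : adj F x y by rewrite /adj -def_e.
case/(adj_edge_pairs simpF) => h; [by exists (x, y)|exists (y, x) => //=].
by rewrite def_e setUC.
Qed.

End Subtrees.

(** * Grown trees and networks versus subgraphs *)

Section Bridge.
Variables (R : realType) (n : nat) (E : {set {set 'I_n}}) (c : {set 'I_n} -> R).
Hypothesis simpE : simple_graph E.
Hypothesis conE : connected_on [set: 'I_n] E.
Hypothesis c_ge0 : forall e, e \in E -> 0 <= c e.

Definition weighted_edges (F : {set {set 'I_n}}) : seq (edge R) :=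
  [seq ((val p.1, val p.2), c [set p.1; p.2]) | p : 'I_n * 'I_n <- edge_pairs F].

Definition vertices (U : {set 'I_n}) : seq nat := [seq val i | i <- enum U].

Let G := sym_edges (weighted_edges E).
Let V := iota 0 n.

Lemma mem_vertices (U : {set 'I_n}) (i : 'I_n) : (val i \in vertices U) = (i \in U).
Proof. by rewrite mem_map ?mem_enum //; apply: val_inj. Qed.

Lemma verticesP (U : {set 'I_n}) v :
  reflect (exists2 i : 'I_n, i \in U & v = val i) (v \in vertices U).
Proof.
apply: (iffP mapP) => -[i iU ->]; exists i => //; first by rewrite -mem_enum.
by rewrite mem_enum.
Qed.

Lemma vertices_V U : {subset vertices U <= V}.
Proof. by move=> v /verticesP[i _ ->]; rewrite mem_iota /= add0n. Qed.

Lemma mem_G a b x : ((a, b), x) \in G <-> exists i j : 'I_n,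
  [/\ a = val i, b = val j, adj E i j & x = c [set i; j]].
Proof.
rewrite mem_cat; split=> [/orP[/mapP[[i j]]|/mapP[g /mapP[[i j]]]]|[i [j [-> -> ij ->]]]].
- by rewrite mem_edge_pairs => /andP[_ ij] [-> -> ->]; exists i, j.
- rewrite mem_edge_pairs => /andP[_ ij] -> [-> -> ->]; exists j, i.
  by rewrite adj_sym setUC.
case: (adj_edge_pairs simpE ij) => h; apply/orP; [left|right].
  by apply/mapP; exists (i, j).
apply/mapP; exists ((val j, val i), c [set j; i]); last by rewrite setUC.
by apply/mapP; exists (j, i).
Qed.

Lemma G_ge0 (g : edge R) : g \in G -> 0 <= g.2.
Proof. by case: g => -[a b] x /mem_G[i [j [_ _ ij ->]]]; apply: c_ge0. Qed.

Lemma G_sym (a b : nat) (x : R) : ((a, b), x) \in G -> ((b, a), x) \in G.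
Proof.
move=> /mem_G[i [j [-> -> ij ->]]]; apply/mem_G; exists j, i.
by rewrite adj_sym setUC.
Qed.

Lemma G_in (a b : nat) (x : R) : ((a, b), x) \in G -> b \in V.
Proof. by move=> /mem_G[i [j [_ -> _ _]]]; rewrite mem_iota /= add0n. Qed.

Lemma G_conn (a b : nat) : a \in V -> b \in V -> exists w, walk G a b w.
Proof.
rewrite !mem_iota /= !add0n => lt_a lt_b.
suff walk_ij (i j : 'I_n) : exists w, walk G (val i) (val j) w.
  exact: (walk_ij (Ordinal lt_a) (Ordinal lt_b)).
have /connectP[p] := conE (in_setT i) (in_setT j).
elim/last_ind: p j => [|p k IHp] j; first by move=> _ ->; exists 0; apply: walk0.
rewrite rcons_path last_rcons => /andP[path_p last_k] ->.
have [w walk_w] := IHp _ path_p erefl.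
exists (w + c [set last i p; k]); apply: walkS walk_w _.
by apply/mem_G; exists (last i p), k.
Qed.

Lemma grown_subtree T r VT ET k : r \in V -> grown G r VT ET k ->
  exists S : subgraph n, [/\ subtree E S,
    forall i : 'I_n, (i \in sverts S) = (val i \in VT),
    forall i j : 'I_n, adj (sedges S) i j = has_edge ET i j
    & tree_cost (STP E c T) S = k].
Proof.
rewrite mem_iota /= add0n => lt_r.
elim=> {VT ET k} [|VT ET k u v x _ [S [treeS vS eS <-]]].
  exists (Subgraph [set Ordinal lt_r] set0); split=> //=.
  - exact: subtree1.
  - by move=> i; rewrite !inE.
  - by move=> i j; rewrite /adj inE.
  - by rewrite /tree_cost big_set0.
move=> + + /mem_G[i [j [def_u def_v ij ->]]]; rewrite {}def_u {}def_v -!vS => iS jS.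
exists (Subgraph (j |: sverts S) ([set i; j] |: sedges S)); split=> /=.
- exact: subtree_leaf.
- by move=> l; rewrite !inE vS.
- move=> a b; rewrite /adj inE -/(adj (sedges S) a b) eS; congr (_ || _).
  by rewrite inE eq_sym set2_eq.
rewrite /tree_cost big_setU1 /= 1?addrC //; have [_ _ sub _ _] := treeS.
by apply: contra jS => /sub/subsetP; apply; rewrite !inE eqxx orbT.
Qed.

Lemma subtree_net S (N := weighted_edges (sedges S)) (Z := vertices (sverts S)) T :
  subtree E S -> [/\ metric G N, within N Z, spans N Z &
    net_cost N = tree_cost (STP E c T) S].
Proof.
move=> [_ /subsetP subE sub_verts conS _].
have simpS : simple_graph (sedges S) by move=> e /subE/simpE.
have NP i j : adj (sedges S) i j -> link N (val i) (val j).
  move=> ij; exists (c [set i; j]).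
  case: (adj_edge_pairs simpS ij) => h; [left|right]; apply/mapP.
    by exists (i, j).
  by exists (j, i) => //=; rewrite setUC.
split.
- move=> a b x /mapP[[i j]]; rewrite mem_edge_pairs => /andP[_ /subE ij] [-> -> ->].
  exists (c [set i; j]) => //; rewrite -[c _]add0r; apply: walkS (walk0 _ _) _.
  by apply/mem_G; exists i, j.
- move=> a b x /mapP[[i j]]; rewrite mem_edge_pairs => /andP[_ ij] [-> -> _].
  have /subsetP sub := sub_verts _ ij.
  by rewrite !mem_vertices !sub // !inE eqxx ?orbT.
- move=> _ _ /verticesP[i iS ->] /verticesP[j jS ->].
  have /connectP[p] := conS _ _ iS jS.
  elim/last_ind: p j {jS} => [|p l IHp] j; first by move=> _ ->; apply: conn_refl.
  rewrite rcons_path last_rcons => /andP[path_p last_l] ->.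
  exact: conn_trans (IHp _ path_p erefl) (conn1 (NP _ _ last_l)).
by rewrite /net_cost /tree_cost big_map /= (sum_edge_pairs c simpS).
Qed.

(** A subgraph is a pair of finite sets, so a cheapest Steiner tree exists once there is one at
    all. *)
Lemma optimal_exists T S : steiner_tree (STP E c T) S ->
  exists OPT, optimal (STP E c T) OPT.
Proof.
move=> steinS; pose sub (p : {set 'I_n} * {set {set 'I_n}}) := Subgraph p.1 p.2.
pose P p := `[< steiner_tree (STP E c T) (sub p) >].
have subK S' : sub (sverts S', sedges S') = S' by case: S'.
have P0 : P (sverts S, sedges S) by apply/asboolP; rewrite subK.
case: (Order.TotalTheory.arg_minP (fun p => tree_cost (STP E c T) (sub p)) P0).
move=> p /asboolP steinp min_p; exists (sub p); split=> // S' steinS'.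
by rewrite -(subK S'); apply: min_p; apply/asboolP; rewrite subK.
Qed.

End Bridge.

(** * Correctness of the algorithm on mathematical data *)

Section Correctness.
Variable R : realType.

Definition stp_input n (I : stp R n) : stp_data R :=
  (n, (weighted_edges (stp_cost I) (stp_edges I), (vertices (stp_terminals I), tt))).

Definition subgraph_output n (S : subgraph n) : subgraph_data :=
  (vertices (sverts S),
   ([seq (val p.1, val p.2) | p : 'I_n * 'I_n <- edge_pairs (sedges S)], tt)).

Definition reopt_input n (I : stp R n) (OPT : subgraph n) (I' : stp R n) :
    reopt_data R :=
  (stp_input I, (subgraph_output OPT, (stp_input I', tt))).

Lemma branching0 (es : seq (edge R)) : branching [::] es = [::].
Proof. by rewrite /branching; elim: es. Qed.

Lemma bestP (ts : seq (tree R)) : ts != [::] ->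
  best ts \in ts /\ forall tr, tr \in ts -> (best ts).2.2 <= tr.2.2.
Proof.
by move=> /(argminP (fun t : tree R => t.2.2))[tr [? + ?]]; rewrite /best => ->.
Qed.

Lemma subgraph_outputE n (E : {set {set 'I_n}}) (c : {set 'I_n} -> R)
    (S : subgraph n) (VT : seq nat) (ET : seq (edge R)) :
  (forall i : 'I_n, (i \in sverts S) = (val i \in VT)) ->
  (forall i j : 'I_n, adj (sedges S) i j = has_edge ET i j) ->
  sedges S \subset E ->
  ([seq v <- iota 0 n | v \in VT],
   ([seq g.1 | g <- [seq g <- weighted_edges c E | has_edge ET g.1.1 g.1.2]], tt))
  = subgraph_output S.
Proof.
move=> vS eS subE; congr (_, (_, tt)).
  rewrite -val_enum_ord filter_map /vertices; congr map; rewrite enumT.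
  by apply: eq_filter => i; rewrite /= -vS.
rewrite filter_map -!map_comp.
have -> : edge_pairs (sedges S) =
    [seq p : 'I_n * 'I_n <- edge_pairs E | has_edge ET (val p.1) (val p.2)].
  rewrite /edge_pairs -filter_predI; apply: eq_filter => p /=.
  rewrite -eS; case: (_ < _)%N; rewrite ?andbF //=.
  by case p12 : (adj _ _ _); rewrite //= /adj (subsetP subE).
by [].
Qed.

Lemma reopt_correct (eps : R) : 0 < eps -> exists m : nat,
  forall (n : nat) (E : {set {set 'I_n}}) (c : {set 'I_n} -> R)
    (T : {set 'I_n}) (t : 'I_n) (OPT : subgraph n),
  let I := STP E c T in let I' := STP E c (T :\ t) in
  stp_instance I -> optimal I OPT -> t \in T ->
  exists S, reopt m (reopt_input I OPT I') = subgraph_output S /\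
    approximate eps I' S.
Proof.
move=> eps_gt0; have [M swapM] := swap_exists eps_gt0; exists M.
move=> n E c T t OPT I I' [simpE conE c_ge0] [steinOPT optOPT] tT.
pose G := sym_edges (weighted_edges c E); pose V := iota 0 n.
have Gge0 : forall g : edge R, g \in G -> 0 <= g.2 := G_ge0 simpE c_ge0.
have Gsym : forall (a b : nat) (x : R),
  ((a, b), x) \in G -> ((b, a), x) \in G := G_sym simpE.
have Gin : forall (a b : nat) (x : R), ((a, b), x) \in G -> b \in V := G_in simpE.
have Gconn : forall a b : nat, a \in V -> b \in V -> exists w, walk G a b w :=
  G_conn c simpE conE.
have lastV Z : {subset Z <= V} -> last 0%N Z \in V.
  case: Z => [_|v Z]; last by apply; apply: mem_last.
  by rewrite mem_iota /= add0n (leq_ltn_trans _ (ltn_ord t)).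
have treeP Z U : {subset Z <= V} -> {subset vertices U <= Z} ->
    exists S, [/\ steiner_tree (STP E c U) S,
      tree_cost (STP E c U) S = (join_tree G V Z).2.2,
      forall i : 'I_n, (i \in sverts S) = (val i \in (join_tree G V Z).1) &
      forall i j : 'I_n, adj (sedges S) i j = has_edge (join_tree G V Z).2.1 i j].
  move=> ZV UZ; have [gr sub] := join_tree_grown Gge0 Gin Gconn (lastV _ ZV) ZV.
  have [S [treeS vS eS cS]] := grown_subtree simpE U (lastV _ ZV) gr.
  exists S; split=> //; split=> //; apply/subsetP => i iU.
  by rewrite vS; apply/sub/UZ; rewrite mem_vertices.
pose Q := vertices (T :\ t).
have QV : {subset Q <= V} by apply: vertices_V.
pose Z0 := vertices (sverts OPT) ++ [seq v <- vertices T | v \notin Q].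
have filter_t : [seq v <- vertices T | v \notin Q] = [:: val t].
  rewrite filter_map.
  rewrite (eq_in_filter (a2 := pred1 t)) ?filter_pred1_uniq ?mem_enum ?enum_uniq //.
  by move=> i; rewrite mem_enum /= mem_vertices !inE => ->; rewrite andbT negbK.
have [treeOPT T_OPT] := steinOPT.
have Z0E : Z0 =i vertices (sverts OPT).
  move=> v; rewrite /Z0 filter_t mem_cat inE orb_idr // => /eqP->.
  by rewrite mem_vertices (subsetP T_OPT).
have Z0V : {subset Z0 <= V} by move=> v; rewrite Z0E; apply: vertices_V.
have last_Z0 : last 0%N Z0 = val t by rewrite /Z0 filter_t last_cat.
pose tr0 := join_tree G V Z0.
have [gr0 sub0] := join_tree_grown Gge0 Gin Gconn (lastV _ Z0V) Z0V.
rewrite last_Z0 in gr0.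
(* The exchange argument is applied to the rebuilt tree [tr0]; since it is no more expensive than
   [OPT], it inherits its optimality. *)
have cost0 : tr0.2.2 <= tree_cost I OPT.
  have [metN withinN spansN <-] := subtree_net c simpE T treeOPT.
  apply: join_tree_cost Gge0 Gsym Gin Gconn _ _ _ Z0V metN _ _.
  - by rewrite /Z0 filter_t -size_eq0 size_cat addn1.
  - by move=> a b x /withinN; rewrite !Z0E.
  - by move=> x y; rewrite !Z0E; apply: spansN.
have [OPT' optOPT'] : exists OPT', optimal I' OPT'.
  apply: (optimal_exists (S := OPT)); split=> //.
  by apply: subset_trans T_OPT; apply: subD1set.
have [[treeOPT' Q_OPT'] _] := optOPT'.
pose k' := tree_cost I' OPT'.
have k'_ge0 : 0 <= k'.
  apply: sumr_ge0 => e eS; apply: c_ge0.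
  by have [_ /subsetP sub _ _ _] := treeOPT'; apply: sub.
pose L := branching Q tr0.2.1.
have [D D_in cost_D] : exists2 D, D \in lists M V &
    (join_tree G V (swap V Q L D)).2.2 <= (1 + eps) * k'.
  (* Without terminals left, the empty [D] gives an empty set of vertices, and [join_tree] returns
     the default root 0 alone, at cost zero. *)
  have [Qnil|Q0] := eqVneq Q [::].
    exists [::]; first exact: mem_lists.
    rewrite /swap /L Qnil branching0 (eq_filter (a2 := pred0)) // filter_pred0.
    by rewrite /join_tree /= mulr_ge0 // addr_ge0 // ltW.
  pose Z1 := vertices (sverts OPT').
  have Z1V : {subset Z1 <= V} by apply: vertices_V.
  have [gr1 sub1] := join_tree_grown Gge0 Gin Gconn (lastV _ Z1V) Z1V.
  have QZ1 : {subset Q <= Z1}.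
    by move=> _ /verticesP[i iQ ->]; rewrite mem_vertices (subsetP Q_OPT').
  have cost1 : (join_tree G V Z1).2.2 <= k'.
    have [metN withinN spansN costN] := subtree_net c simpE (T :\ t) treeOPT'.
    rewrite -[k']/(tree_cost (STP E c (T :\ t)) OPT') -costN.
    apply: join_tree_cost Gge0 Gsym Gin Gconn _ _ _ Z1V metN withinN spansN.
    by case: (Q) Q0 QZ1 => // q s _ /(_ q (mem_head _ _)); case: (Z1).
  have [||||D [N [D_in metN withinN spansN cost_N]]] := swapM G V Gge0 Gin (iota_uniq _ _)
      (val t) Q _ _ _ _ _ _ _ _ Q0 QV gr0 _ gr1 _ (lastV _ Z1V).
  - by rewrite mem_iota /= add0n.
  - move=> q /verticesP[i]; rewrite inE => /andP[_ iT] ->; apply: sub0.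
    by rewrite Z0E mem_vertices (subsetP T_OPT).
  - by move=> q /QZ1/sub1.
  (* [OPT] is optimal among trees, so the network is first turned into a Steiner tree of the old
     instance by [join_tree], at no greater cost. *)
  - move=> N Z metN withinN spansN tZ QZ ZV; apply: le_trans cost0 _.
    have [|S [steinS costS _ _]] := treeP Z T ZV.
      move=> _ /verticesP[i iT ->]; have [-> //|i_ne] := eqVneq i t.
      by apply: QZ; rewrite mem_vertices !inE i_ne.
    apply: le_trans (optOPT _ steinS) _; rewrite costS.
    apply: join_tree_cost Gge0 Gsym Gin Gconn _ _ _ ZV metN withinN spansN.
    by case: (Z) tZ.
  exists D => //; apply: le_trans (_ : _ <= net_cost N) _.
    apply: join_tree_cost Gge0 Gsym Gin Gconn _ _ _ _ metN withinN spansN.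
      have [q qQ] : exists q, q \in Q.
        by case: (Q) Q0 => // q s; exists q; rewrite mem_head.
      have : q \in swap V Q L D by rewrite mem_filter qQ QV.
      by rewrite -/tr0 -/L; case: (swap V Q L D).
    by move=> v; rewrite mem_filter => /andP[].
  apply: le_trans cost_N _; rewrite ler_wpM2l // addr_ge0 // ltW //.
pose ts := candidates M n G (vertices T) (vertices (sverts OPT)) Q.
have D_ts : join_tree G V (swap V Q L D) \in ts by apply: map_f.
have [] := @bestP ts; first by case: (ts) D_ts.
case/mapP=> D' _ best_def /(_ _ D_ts) best_le.
have [||S [steinS costS vS eS]] := treeP (swap V Q L D') (T :\ t).
- by move=> v; rewrite mem_filter => /andP[].
- by move=> v vQ; rewrite mem_filter vQ (QV _ vQ).
exists S; split.
  rewrite -(subgraph_outputE (E := E) c vS eS); last by case: steinS => -[].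
  by rewrite /reopt /reopt_input /stp_input /= -/G -/ts best_def.
split=> //; exists OPT'; split=> //; rewrite costS.
by move: best_le; rewrite best_def => /le_trans; apply.
Qed.

End Correctness.

(** * Polynomial-time functions *)

Section PolynomialTime.
Local Open Scope nat_scope.
Variable R : realType.

Class Enc (X : Type) := enc : X -> data R.

#[global] Instance enc_nat_inst : Enc nat := enc_nat R.
#[global] Instance enc_real_inst : Enc R := @DReal R.
#[global] Instance enc_bool_inst : Enc bool := data_bool R.
#[global] Instance enc_unit_inst : Enc unit := fun=> DNil.
#[global] Instance enc_pair_inst X Y (eX : Enc X) (eY : Enc Y) : Enc (X * Y) :=
  fun p => DCons (enc p.1) (enc p.2).
#[global] Instance enc_seq_inst X (eX : Enc X) : Enc (seq X) :=
  fun s => enc_list (map enc s).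

Definition sz X {eX : Enc X} (x : X) : nat := data_size (enc x).

Lemma data_size_gt0 (d : data R) : 0 < data_size d.
Proof. by case: d. Qed.

Lemma sz_gt0 X {eX : Enc X} (x : X) : 0 < sz x.
Proof. exact: data_size_gt0. Qed.

Lemma sz_pair X Y {eX : Enc X} {eY : Enc Y} (p : X * Y) :
  sz p = (sz p.1 + sz p.2).+1.
Proof. by []. Qed.

Lemma sz_nil X {eX : Enc X} : sz ([::] : seq X) = 1.
Proof. by []. Qed.

Lemma sz_cons X {eX : Enc X} (x : X) s : sz (x :: s) = (sz x + sz s).+1.
Proof. by []. Qed.

Lemma sz_nat (m : nat) : sz m = m.*2.+1.
Proof.
elim: m => [//|m IHm]; have -> : sz m.+1 = (sz (@nil nat) + sz m).+1 by [].
by rewrite IHm sz_nil; lia.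
Qed.

Lemma enc_nseq (m : nat) : enc (nseq m tt) = enc m.
Proof.
elim: m => // m IHm; have -> : enc m.+1 = DCons DNil (enc m) by [].
by rewrite -IHm.
Qed.

Lemma sz_bool_le (b : bool) : sz b <= 3.
Proof. by case: b. Qed.

(** A single monomial is enough because sizes are positive. *)
Definition poly_bounded X {eX : Enc X} (b : X -> nat) : Prop :=
  exists C D, forall x, b x <= C * sz x ^ D.

Lemma pb_le X {eX : Enc X} (b b' : X -> nat) :
  (forall x, b x <= b' x) -> poly_bounded b' -> poly_bounded b.
Proof.
by move=> le_bb' [C [D h]]; exists C, D => x; apply: leq_trans (h x).
Qed.

Lemma pb_const X {eX : Enc X} c : poly_bounded (fun _ : X => c).
Proof. by exists c, 0 => x; rewrite muln1. Qed.

Lemma pb_sz X {eX : Enc X} : poly_bounded (fun x : X => sz x).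
Proof. by exists 1, 1 => x; rewrite mul1n. Qed.

Lemma pb_add X {eX : Enc X} (b1 b2 : X -> nat) :
  poly_bounded b1 -> poly_bounded b2 -> poly_bounded (fun x => b1 x + b2 x).
Proof.
move=> [C1 [D1 h1]] [C2 [D2 h2]]; exists (C1 + C2), (maxn D1 D2) => x.
by rewrite mulnDl leq_add // (leq_trans (h1 x), leq_trans (h2 x)) //
  leq_mul2l leq_pexp2l ?orbT ?sz_gt0 ?leq_maxl ?leq_maxr.
Qed.

Lemma pb_mul X {eX : Enc X} (b1 b2 : X -> nat) :
  poly_bounded b1 -> poly_bounded b2 -> poly_bounded (fun x => b1 x * b2 x).
Proof.
move=> [C1 [D1 h1]] [C2 [D2 h2]]; exists (C1 * C2), (D1 + D2) => x.
by rewrite expnD mulnACA leq_mul.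
Qed.

Lemma leq_exp2rW m n D : m <= n -> m ^ D <= n ^ D.
Proof. by case: D => // D le_mn; rewrite leq_exp2r. Qed.

Lemma pb_exp X {eX : Enc X} (b : X -> nat) D :
  poly_bounded b -> poly_bounded (fun x => b x ^ D).
Proof.
move=> [C1 [D1 h1]]; exists (C1 ^ D), (D1 * D) => x.
by rewrite expnM -expnMn leq_exp2rW.
Qed.

Lemma pb_comp X Y {eX : Enc X} {eY : Enc Y} (b : Y -> nat) (f : X -> Y) :
  poly_bounded b -> poly_bounded (fun x => sz (f x)) ->
  poly_bounded (fun x => b (f x)).
Proof.
move=> [C [D h]] bf; apply: pb_le (pb_mul (pb_const C) (pb_exp D bf)) => x.
exact: h.
Qed.

Definition slice (Q : program) o (p : program) : Prop :=
  forall i, i < size p -> nth ENil Q (o + i) = nth ENil p i.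

Lemma slice_cat Q o p1 p2 :
  slice Q o (p1 ++ p2) -> slice Q o p1 /\ slice Q (o + size p1) p2.
Proof.
move=> h; split=> i lt_i.
  by rewrite h ?nth_cat ?lt_i // size_cat ltn_addr.
by rewrite -addnA h ?nth_cat ?size_cat ?ltn_add2l // ltnNge leq_addr addKn.
Qed.

Lemma slice_cons Q o e p :
  slice Q o (e :: p) -> nth ENil Q o = e /\ slice Q o.+1 p.
Proof.
move=> h; split=> [|i lt_i]; first by rewrite -[o]addn0 h.
by rewrite addSnnS h.
Qed.

(* Code is parameterized by the index at which it is placed in the program, so
   that programs can be combined without renaming their calls. *)
Definition ptime X Y {eX : Enc X} {eY : Enc Y} (f : X -> Y) : Prop :=
  exists (P : nat -> program) (t : X -> nat),
    [/\ poly_bounded t, poly_bounded (fun x => sz (f x)) &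
      forall o Q, slice Q o (P o) -> forall x, exists2 k, k <= t x &
        eval Q [:: enc x] (nth ENil Q o) (enc (f x)) k].

Lemma pt_size X Y {eX : Enc X} {eY : Enc Y} (f : X -> Y) :
  ptime f -> poly_bounded (fun x => sz (f x)).
Proof. by case=> P [t []]. Qed.

Lemma pt_ext X Y {eX : Enc X} {eY : Enc Y} (f g : X -> Y) :
  f =1 g -> ptime f -> ptime g.
Proof. by move=> /funext->. Qed.

Lemma eval_call0 Q env f v w k :
  eval (R := R) Q [:: v] (nth ENil Q f) w k ->
  eval Q (v :: env) (ECall f (EVar 0)) w k.+2.
Proof. by move=> h; have := eval_call (eval_var Q (v :: env) 0) h; apply. Qed.

Ltac pb := repeat first
  [assumption | apply: pb_const | apply: pb_sz | by apply: pt_size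
  | apply: pb_add | apply: pb_mul | apply: pb_exp].

(** * Code for the elementary operations *)

Section Primitives.
Context {X Y1 Y2 Y3 Z : Type} {eX : Enc X} {eY1 : Enc Y1} {eY2 : Enc Y2}.
Context {eY3 : Enc Y3} {eZ : Enc Z}.

(** The code of three subroutines is laid out behind [e], which receives their addresses. The
    evaluations of the calls are given as hypotheses on [e], so that a conditional can use just the
    branch it takes. *)
Lemma pt_prim3 (e : nat -> nat -> nat -> expr) (f1 : X -> Y1) (f2 : X -> Y2)
    (f3 : X -> Y3) (h : X -> Z) :
  ptime f1 -> ptime f2 -> ptime f3 -> poly_bounded (fun x => sz (h x)) ->
  (forall Q o1 o2 o3 x k1 k2 k3,
    eval Q [:: enc x] (ECall o1 (EVar 0)) (enc (f1 x)) k1 ->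
    eval Q [:: enc x] (ECall o2 (EVar 0)) (enc (f2 x)) k2 ->
    eval Q [:: enc x] (ECall o3 (EVar 0)) (enc (f3 x)) k3 ->
    exists2 k, k <= k1 + k2 + k3 + 4 &
      eval Q [:: enc x] (e o1 o2 o3) (enc (h x)) k) ->
  ptime h.
Proof.
move=> [P1 [t1 [b1 _ h1]]] [P2 [t2 [b2 _ h2]]] [P3 [t3 [b3 _ h3]]] bh he.
exists (fun o => let o1 := o.+1 in let o2 := o1 + size (P1 o1) in
  let o3 := o2 + size (P2 o2) in e o1 o2 o3 :: P1 o1 ++ P2 o2 ++ P3 o3).
exists (fun x => t1 x + t2 x + t3 x + 10).
split=> [||o Q /=]; first by do !apply: pb_add => //; apply: pb_const.
  by [].
move=> /slice_cons[-> /slice_cat[s1 /slice_cat[s2 s3]]] x.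
have [k1 le1 ev1] := h1 _ _ s1 x.
have [k2 le2 ev2] := h2 _ _ s2 x.
have [k3 le3 ev3] := h3 _ _ s3 x.
have [k le_k ev] := he Q _ _ _ x _ _ _ (eval_call0 [::] ev1)
  (eval_call0 [::] ev2) (eval_call0 [::] ev3).
by exists k => //; apply: leq_trans le_k _; lia.
Qed.

End Primitives.

Section Primitives12.
Context {X Y Z W : Type} {eX : Enc X} {eY : Enc Y} {eZ : Enc Z} {eW : Enc W}.

Lemma pt_prim2 (e : nat -> nat -> expr) (f1 : X -> Y) (f2 : X -> Z)
    (h : X -> W) :
  ptime f1 -> ptime f2 -> poly_bounded (fun x => sz (h x)) ->
  (forall Q o1 o2 x k1 k2,
    eval Q [:: enc x] (ECall o1 (EVar 0)) (enc (f1 x)) k1 ->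
    eval Q [:: enc x] (ECall o2 (EVar 0)) (enc (f2 x)) k2 ->
    exists2 k, k <= k1 + k2 + 4 &
      eval Q [:: enc x] (e o1 o2) (enc (h x)) k) ->
  ptime h.
Proof.
move=> p1 p2 bh he; apply: (pt_prim3 (e := fun o1 o2 _ => e o1 o2) p1 p2 p2 bh).
move=> Q o1 o2 o3 x k1 k2 k3 ev1 ev2 _.
by have [k le_k ev] := he _ _ _ _ _ _ ev1 ev2; exists k => //; lia.
Qed.

Lemma pt_prim1 (e : nat -> expr) (f1 : X -> Y) (h : X -> Z) :
  ptime f1 -> poly_bounded (fun x => sz (h x)) ->
  (forall Q o1 x k1,
    eval Q [:: enc x] (ECall o1 (EVar 0)) (enc (f1 x)) k1 ->
    exists2 k, k <= k1 + 4 & eval Q [:: enc x] (e o1) (enc (h x)) k) ->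
  ptime h.
Proof.
move=> p1 bh he.
apply: (pt_prim3 (e := fun o1 _ _ => e o1) p1 p1 p1 bh).
move=> Q o1 o2 o3 x k1 k2 k3 ev1 _ _.
by have [k le_k ev] := he _ _ _ _ ev1; exists k => //; lia.
Qed.

End Primitives12.

Lemma pt_id X {eX : Enc X} : ptime (fun x : X => x).
Proof.
exists (fun=> [:: EVar 0]), (fun=> 1); split; [exact: pb_const|exact: pb_sz|].
move=> o Q /slice_cons[-> _] x; exists 1 => //.
by have := eval_var Q [:: enc x] 0; apply.
Qed.

Lemma pt_const X Y {eX : Enc X} {eY : Enc Y} (e : expr) (c : Y) k :
  (forall Q env, eval Q env e (enc c) k) -> ptime (fun _ : X => c).
Proof.
move=> ev; exists (fun=> [:: e]), (fun=> k).
split; [exact: pb_const|exact: pb_const|].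
by move=> o Q /slice_cons[-> _] x; exists k.
Qed.

Section Rules.
Context {X Y Z : Type} {eX : Enc X} {eY : Enc Y} {eZ : Enc Z}.

Lemma pt_app (g : Y -> Z) (f : X -> Y) :
  ptime g -> ptime f -> ptime (fun x => g (f x)).
Proof.
move=> [P1 [t1 [b1 c1 h1]]] [P2 [t2 [b2 c2 h2]]].
exists (fun o => let o1 := o.+1 in let o2 := o1 + size (P1 o1) in
  ECall o1 (ECall o2 (EVar 0)) :: P1 o1 ++ P2 o2).
exists (fun x => t1 (f x) + t2 x + 10); split=> [||o Q /=].
- by do !apply: pb_add => //; [apply: pb_comp|apply: pb_const].
- exact: (pb_comp c1 c2).
move=> /slice_cons[-> /slice_cat[s1 s2]] x.
have [k2 le2 ev2] := h2 _ _ s2 x.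
have [k1 le1 ev1] := h1 _ _ s1 (f x).
by exists (k2.+2 + k1).+1; [lia | apply: eval_call ev1; apply: eval_call0].
Qed.

Lemma pt_pair (f : X -> Y) (g : X -> Z) :
  ptime f -> ptime g -> ptime (fun x => (f x, g x)).
Proof.
move=> pf pg; apply: (pt_prim2
  (e := fun o1 o2 => ECons (ECall o1 (EVar 0)) (ECall o2 (EVar 0))) pf pg).
  apply: (pb_le (b' := fun x => sz (f x) + sz (g x) + 1)).
    by move=> x; rewrite ?sz_pair ?sz_cons /=; lia.
  by pb.
by move=> Q o1 o2 x k1 k2 e1 e2; eexists; last exact: (eval_cons e1 e2); lia.
Qed.

Lemma pt_if (b : X -> bool) (f g : X -> Y) :
  ptime b -> ptime f -> ptime g -> ptime (fun x => if b x then f x else g x).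
Proof.
move=> pb pf pg; apply: (pt_prim3
  (e := fun o1 o2 o3 => EIf (ECall o1 (EVar 0))
      (ECall o2 (EVar 0)) (ECall o3 (EVar 0))) pb pf pg).
  apply: (pb_le (b' := fun x => sz (f x) + sz (g x))).
    by move=> x; case: (b x); lia.
  by pb.
move=> Q o1 o2 o3 x k1 k2 k3 e1 e2 e3.
exists (k1 + (if b x then k2 else k3)).+1; first by case: ifP; lia.
by apply: (eval_if e1); rewrite /enc; case: (b x).
Qed.

Lemma pt_fst (f : X -> Y * Z) : ptime f -> ptime (fun x => (f x).1).
Proof.
move=> pf; apply: (pt_prim1 (e := fun o1 => EHd (ECall o1 (EVar 0))) pf).
  apply: (pb_le (b' := fun x => sz (f x))); last exact: pt_size.
  by move=> x; rewrite ?sz_pair ?sz_cons /=; lia.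
by move=> Q o x k e; eexists; last exact: (eval_hd e); lia.
Qed.

Lemma pt_snd (f : X -> Y * Z) : ptime f -> ptime (fun x => (f x).2).
Proof.
move=> pf; apply: (pt_prim1 (e := fun o1 => ETl (ECall o1 (EVar 0))) pf).
  apply: (pb_le (b' := fun x => sz (f x))); last exact: pt_size.
  by move=> x; rewrite ?sz_pair ?sz_cons /=; lia.
by move=> Q o x k e; eexists; last exact: (eval_tl e); lia.
Qed.

Lemma pt_cons (f : X -> Y) (g : X -> seq Y) :
  ptime f -> ptime g -> ptime (fun x => f x :: g x).
Proof.
move=> pf pg; apply: (pt_prim2
  (e := fun o1 o2 => ECons (ECall o1 (EVar 0)) (ECall o2 (EVar 0))) pf pg).
  apply: (pb_le (b' := fun x => sz (f x) + sz (g x) + 1)).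
    by move=> x; rewrite ?sz_pair ?sz_cons /=; lia.
  by pb.
by move=> Q o1 o2 x k1 k2 e1 e2; eexists; last exact: (eval_cons e1 e2); lia.
Qed.

Lemma pt_nil : ptime (fun _ : X => [::] : seq Y).
Proof. by apply: (pt_const (e := ENil)) => Q env; apply: eval_nil. Qed.

End Rules.

Lemma pt_p1 X Y {eX : Enc X} {eY : Enc Y} : ptime (fun p : X * Y => p.1).
Proof. exact: pt_fst (@pt_id _ _). Qed.

Lemma pt_p2 X Y {eX : Enc X} {eY : Enc Y} : ptime (fun p : X * Y => p.2).
Proof. exact: pt_snd (@pt_id _ _). Qed.

Lemma pt_zero X {eX : Enc X} : ptime (fun _ : X => 0%R : R).
Proof. by apply: (pt_const (e := EZero)) => Q env; apply: eval_zero. Qed.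

Lemma pt_true X {eX : Enc X} : ptime (fun _ : X => true).
Proof.
apply: (pt_const (e := ECons ENil ENil)) => Q env.
exact: (eval_cons (eval_nil _ _) (eval_nil _ _)).
Qed.

Lemma pt_false X {eX : Enc X} : ptime (fun _ : X => false).
Proof. by apply: (pt_const (e := ENil)) => Q env; apply: eval_nil. Qed.

Lemma pt_nat0 X {eX : Enc X} : ptime (fun _ : X => 0).
Proof. by apply: (pt_const (e := ENil)) => Q env; apply: eval_nil. Qed.

Lemma pt_unit X {eX : Enc X} : ptime (fun _ : X => tt).
Proof. by apply: (pt_const (e := ENil)) => Q env; apply: eval_nil. Qed.

Lemma pt_addr X {eX : Enc X} (f g : X -> R) :
  ptime f -> ptime g -> ptime (fun x => f x + g x)%R.
Proof.
move=> pf pg; apply: (pt_prim2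
  (e := fun o1 o2 => EAdd (ECall o1 (EVar 0)) (ECall o2 (EVar 0))) pf pg).
  exact: (pb_const 1).
by move=> Q o1 o2 x k1 k2 e1 e2; eexists; last exact: (eval_add e1 e2); lia.
Qed.

Lemma pt_ler X {eX : Enc X} (f g : X -> R) :
  ptime f -> ptime g -> ptime (fun x => f x <= g x)%R.
Proof.
move=> pf pg; apply: (pt_prim2
  (e := fun o1 o2 => ELeq (ECall o1 (EVar 0)) (ECall o2 (EVar 0))) pf pg).
  by apply: pb_le (pb_const 3) => x; apply: sz_bool_le.
by move=> Q o1 o2 x k1 k2 e1 e2; eexists; last exact: (eval_leq e1 e2); lia.
Qed.

Lemma pt_succ X {eX : Enc X} (f : X -> nat) :
  ptime f -> ptime (fun x => (f x).+1).
Proof.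
move=> pf; apply: (pt_prim1 (e := fun o1 => ECons ENil (ECall o1 (EVar 0))) pf).
  by apply: (pb_le (b' := fun x => sz (f x) + 2)); [move=> x; rewrite addn2|pb].
by move=> Q o1 x k1 e1; eexists; last exact: (eval_cons (eval_nil _ _) e1); lia.
Qed.

Lemma pt_pred X {eX : Enc X} (f : X -> nat) :
  ptime f -> ptime (fun x => (f x).-1).
Proof.
move=> pf; apply: (pt_prim1 (e := fun o1 => ETl (ECall o1 (EVar 0))) pf).
  apply: (pb_le (b' := fun x => sz (f x))); last by pb.
  by move=> x; rewrite !sz_nat; lia.
move=> Q o1 x k1 e1; exists k1.+1; first lia.
by have := eval_tl e1; case: (f x).
Qed.

Lemma pt_iszero X {eX : Enc X} (f : X -> nat) :
  ptime f -> ptime (fun x => f x == 0).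
Proof.
move=> pf; apply: (pt_prim1 (e := fun o1 =>
  EIf (ECall o1 (EVar 0)) ENil (ECons ENil ENil)) pf).
  by apply: pb_le (pb_const 3) => x; apply: sz_bool_le.
move=> Q o1 x k1 e1; case: (f x) e1 => [|y] e1; rewrite ?eqxx.
  exists (k1 + 3).+1; first lia.
  exact: (eval_if e1 (eval_cons (eval_nil _ _) (eval_nil _ _))).
exists (k1 + 1).+1; first lia.
exact: (eval_if e1 (eval_nil _ _)).
Qed.

(** A unary number and a list of units have the same encoding, so the conversion takes no code; it
    reduces recursion on numbers to folds. *)
Lemma pt_iter_list X {eX : Enc X} (f : X -> nat) :
  ptime f -> ptime (fun x => nseq (f x) tt).
Proof.
move=> pf; apply: (pt_prim1 (e := fun o1 => ECall o1 (EVar 0)) pf).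
  apply: (pb_le (b' := fun x => sz (f x))); last by pb.
  by move=> x; rewrite /sz enc_nseq.
by move=> Q o1 x k1 e1; exists k1; [lia | rewrite enc_nseq].
Qed.

Section Fold.
Context {X Y S : Type} {eX : Enc X} {eY : Enc Y} {eS : Enc S}.
Variables (l : X -> seq Y) (i : X -> S) (st : X -> Y -> S -> S).

Let f x := foldl (fun s y => st x y s) (i x) (l x).

(** The argument encodes [(x, (ys, s))]. Functions see nothing but their argument, so the parameter
    [x] travels along with the rest of the list and the accumulator. *)
Let loop o os :=
  EIf (EHd (ETl (EVar 0)))
    (ECall o (ECons (EHd (EVar 0)) (ECons (ETl (EHd (ETl (EVar 0))))
       (ECall os (ECons (ECons (EHd (EVar 0)) (EHd (EHd (ETl (EVar 0)))))
                        (ETl (ETl (EVar 0))))))))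
    (ETl (ETl (EVar 0))).

Let eval_loop Q o os T x L B :
  nth ENil Q o = loop o os ->
  (forall y s, sz y <= L -> sz s <= B -> exists2 k, k <= T &
     eval Q [:: enc (x, y, s)] (nth ENil Q os) (enc (st x y s)) k) ->
  forall ys s, sz ys <= L ->
  (forall k, k <= size ys ->
    sz (foldl (fun s y => st x y s) s (take k ys)) <= B) ->
  exists2 k, k <= size ys * (T + 30) + 10 &
    eval Q [:: enc (x, (ys, s))] (nth ENil Q o)
      (enc (foldl (fun s y => st x y s) s ys)) k.
Proof.
move=> Qo ev_st; elim=> [|y ys IHys] s le_ys le_s; rewrite Qo.
  have v : eval Q [:: enc (x, ([::] : seq Y, s))] (EVar 0)
      (enc (x, ([::] : seq Y, s))) 1.
    exact: (eval_var Q [:: _] 0).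
  eexists; last exact: (eval_if (eval_hd (eval_tl v)) (eval_tl (eval_tl v))).
  by [].
rewrite sz_cons in le_ys.
have [||k1 le_k1 ev1] := ev_st y s; [lia|exact: (le_s 0)|].
have [||k2 le_k2 ev2] := IHys (st x y s); first lia.
  by move=> k le_k; apply: (le_s k.+1).
have v : eval Q [:: enc (x, (y :: ys, s))] (EVar 0) (enc (x, (y :: ys, s))) 1.
  exact: (eval_var Q [:: _] 0).
eexists; last first.
  apply: (eval_if (eval_hd (eval_tl v))).
  apply: (eval_call _ ev2); apply: (eval_cons (eval_hd v)).
  apply: (eval_cons (eval_tl (eval_hd (eval_tl v)))).
  apply: (eval_call _ ev1); apply: (eval_cons _ (eval_tl (eval_tl v))).
  exact: (eval_cons (eval_hd v) (eval_hd (eval_hd (eval_tl v)))).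
by rewrite /= mulSn; lia.
Qed.

(* Intermediate values of the accumulator must have polynomial size: by sharing,
   the size of a tree may double in a single time unit. *)
Lemma pt_foldl (b : X -> nat) :
  ptime l -> ptime i -> ptime (fun p : X * Y * S => st p.1.1 p.1.2 p.2) ->
  poly_bounded b ->
  (forall x k, k <= size (l x) ->
     sz (foldl (fun s y => st x y s) (i x) (take k (l x))) <= b x) ->
  ptime f.
Proof.
move=> [P1 [t1 [b1 c1 h1]]] [P2 [t2 [b2 c2 h2]]] [P3 [t3 [[C [D b3]] _ h3]]].
move=> bb le_b.
pose (T := fun x => C * (sz x + sz (l x) + b x + 2) ^ D).
exists (fun o => let o1 := o.+2 in let o2 := o1 + size (P1 o1) in
  let o3 := o2 + size (P2 o2) in
  ECall o.+1 (ECons (EVar 0)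
     (ECons (ECall o1 (EVar 0)) (ECall o2 (EVar 0)))) ::
  loop o.+1 o3 :: P1 o1 ++ P2 o2 ++ P3 o3).
exists (fun x => t1 x + t2 x + sz (l x) * (T x + 30) + 30).
split=> [||o Q /=].
- have bT : poly_bounded T by rewrite /T; pb.
  by pb.
- apply: pb_le bb => x; have := le_b x (size (l x)).
  by rewrite take_size; apply.
move=> /slice_cons[-> /slice_cons[Qo1 /slice_cat[s1 /slice_cat[s2 s3]]]] x.
have [k1 le1 ev1] := h1 _ _ s1 x.
have [k2 le2 ev2] := h2 _ _ s2 x.
have [|||k le_k ev] := eval_loop (T := T x) (x := x) (L := sz (l x)) (B := b x)
  Qo1 _ (ys := l x) (s := i x).
- move=> y s le_y le_s; have [k le_k ev] := h3 _ _ s3 (x, y, s).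
  exists k => //; apply: leq_trans le_k _; apply: leq_trans (b3 _) _.
  by rewrite leq_mul2l leq_exp2rW ?orbT // !sz_pair /=; lia.
- by [].
- by move=> k; apply: le_b.
eexists; last first.
  apply: (eval_call _ ev).
  apply: (eval_cons (eval_var Q [:: enc x] 0)).
  exact: (eval_cons (eval_call0 [::] ev1) (eval_call0 [::] ev2)).
have : size (l x) * (T x + 30) <= sz (l x) * (T x + 30).
  rewrite leq_mul2r; apply/orP; right.
  by elim: (l x) => //= y ys; rewrite sz_cons; lia.
lia.
Qed.

End Fold.
Section FoldAdd.
Context {X Y S : Type} {eX : Enc X} {eY : Enc Y} {eS : Enc S}.

(** If a step enlarges the accumulator by an amount that does not depend on it, the sizes add up
    instead of multiplying. *)
Lemma pt_foldl_add (B : X * Y -> nat) (l : X -> seq Y) (i : X -> S)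
    (st : X -> Y -> S -> S) :
  ptime l -> ptime i -> ptime (fun p : X * Y * S => st p.1.1 p.1.2 p.2) ->
  poly_bounded B -> (forall x y s, sz (st x y s) <= sz s + B (x, y)) ->
  ptime (fun x => foldl (fun s y => st x y s) (i x) (l x)).
Proof.
move=> pl pi pst [C [D le_B]] le_st.
apply: (pt_foldl
  (b := fun x => sz (i x) + sz (l x) * (C * (sz x + sz (l x) + 1) ^ D))) => //.
  by pb.
move=> x k _; set T := C * _.
have le_take : sz (take k (l x)) <= sz (l x).
  elim: (l x) k => [|y ys IHys] [|k] //=; rewrite !sz_cons ?sz_nil //.
  by have := IHys k; lia.
have fold_le : forall ys s, sz ys <= sz (l x) ->
    sz (foldl (fun s y => st x y s) s ys) <= sz s + sz ys * T.
  elim=> [|y ys IHys] s /=; first lia.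
  rewrite sz_cons => le_ys; apply: leq_trans (IHys _ _) _; first lia.
  have le_T : B (x, y) <= T.
    apply: leq_trans (le_B _) _; rewrite leq_mul2l leq_exp2rW ?orbT //.
    by rewrite sz_pair /=; lia.
  by have := le_st x y s; rewrite mulSn mulnDl; lia.
by apply: leq_trans (fold_le _ _ le_take) _; rewrite leq_add2l leq_mul2r le_take orbT.
Qed.

End FoldAdd.

Section Booleans.
Context {X : Type} {eX : Enc X}.
Implicit Types a b : X -> bool.

Lemma pt_and a b : ptime a -> ptime b -> ptime (fun x => a x && b x).
Proof. by move=> pa pb; apply: (pt_if (g := fun=> false) pa pb); apply: pt_false. Qed.

Lemma pt_or a b : ptime a -> ptime b -> ptime (fun x => a x || b x).
Proof. by move=> pa pb; apply: (pt_if (f := fun=> true) pa _ pb); apply: pt_true. Qed.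

Lemma pt_neg a : ptime a -> ptime (fun x => ~~ a x).
Proof.
move=> pa; apply: (pt_if (f := fun=> false) (g := fun=> true) pa).
  exact: pt_false.
exact: pt_true.
Qed.

Lemma pt_xor a b : ptime a -> ptime b -> ptime (fun x => a x (+) b x).
Proof. move=> pa pb; apply: pt_ext (pt_if pa (pt_neg pb) pb) => x.
by case: (a x). Qed.

Lemma pt_subn (f g : X -> nat) :
  ptime f -> ptime g -> ptime (fun x => f x - g x).
Proof.
move=> pf pg; have pl := pt_iter_list pg.
apply: pt_ext (_ : ptime (fun x => foldl (fun s (_ : unit) => s.-1)
    (f x) (nseq (g x) tt))) => [x|].
  by elim: (g x) (f x) => [|m IHm] p; rewrite /= ?subn0 // IHm -subn1 -subnDA.
apply: (pt_foldl_add (B := fun=> 0) (st := fun _ _ s => s.-1)) => //.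
- by apply/pt_pred/pt_p2.
- exact: pb_const.
- by move=> x _ s; rewrite !sz_nat; lia.
Qed.

Lemma pt_leqn (f g : X -> nat) :
  ptime f -> ptime g -> ptime (fun x => f x <= g x).
Proof. by move=> pf pg; apply/pt_iszero/pt_subn. Qed.

Lemma pt_eqn (f g : X -> nat) :
  ptime f -> ptime g -> ptime (fun x => f x == g x).
Proof.
move=> pf pg; apply: pt_ext (pt_and (pt_leqn pf pg) (pt_leqn pg pf)) => x.
by rewrite eqn_leq.
Qed.

End Booleans.

Section Lists.
Context {X Y : Type} {eX : Enc X} {eY : Enc Y}.

Lemma pt_catrev (f g : X -> seq Y) :
  ptime f -> ptime g -> ptime (fun x => catrev (f x) (g x)).
Proof.
move=> pf pg.
apply: pt_ext (_ : ptime (fun x => foldl (fun s y => y :: s) (g x) (f x))).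
  by move=> x; elim: (f x) (g x) => //= y s IH s'; rewrite IH.
apply: (pt_foldl_add (B := fun p => sz p) (st := fun _ y s => y :: s)) => //.
- by apply: pt_cons; [apply/pt_snd/pt_fst/pt_id | apply: pt_p2].
- exact: pb_sz.
- by move=> x y s; rewrite sz_cons sz_pair /=; lia.
Qed.

Lemma pt_rev (f : X -> seq Y) : ptime f -> ptime (fun x => rev (f x)).
Proof. by move=> pf; apply: pt_catrev => //; apply: pt_nil. Qed.

Lemma pt_cat (f g : X -> seq Y) :
  ptime f -> ptime g -> ptime (fun x => f x ++ g x).
Proof.
move=> pf pg; apply: pt_ext (pt_catrev (pt_rev pf) pg) => x.
by rewrite catrevE revK.
Qed.

Lemma pt_has (l : X -> seq Y) (a : X -> Y -> bool) :
  ptime l -> ptime (fun p : X * Y => a p.1 p.2) ->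
  ptime (fun x => has (a x) (l x)).
Proof.
move=> pl pa.
apply: pt_ext (_ : ptime (fun x => foldl (fun s y => s || a x y) false (l x))).
  move=> x; rewrite -[RHS]orFb; elim: (l x) false => [|y s IH] b /=.
    by rewrite orbF.
  by rewrite IH orbA.
apply: (pt_foldl_add (B := fun=> 3) (st := fun x y s => s || a x y)) => //.
- exact: pt_false.
- apply: pt_or; first exact: pt_p2.
  exact: (pt_app pa pt_p1).
- exact: pb_const.
- by move=> x y s; have := sz_bool_le (s || a x y); lia.
Qed.

End Lists.

Section MapFilter.
Context {X Y Z : Type} {eX : Enc X} {eY : Enc Y} {eZ : Enc Z}.

Lemma pt_map (l : X -> seq Y) (f : X -> Y -> Z) :
  ptime l -> ptime (fun p : X * Y => f p.1 p.2) ->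
  ptime (fun x => map (f x) (l x)).
Proof.
move=> pl pf.
apply: pt_ext (_ : ptime (fun x => rev (foldl (fun s y => f x y :: s) [::] (l x)))).
  move=> x; have E r : rev (foldl (fun s y => f x y :: s) r (l x)) =
      rev r ++ map (f x) (l x).
    elim: (l x) r => [|y s IH] r /=; first by rewrite cats0.
    by rewrite IH rev_cons cat_rcons.
  exact: E.
apply: pt_rev.
apply: (pt_foldl_add (B := fun p => sz (f p.1 p.2) + 1)
  (st := fun x y s => f x y :: s)) => //.
- exact: pt_nil.
- apply: pt_cons; last exact: pt_p2.
  exact: (pt_app pf pt_p1).
- by pb.
- by move=> x y s; rewrite sz_cons /=; lia.
Qed.

Lemma pt_filter (l : X -> seq Y) (a : X -> Y -> bool) :
  ptime l -> ptime (fun p : X * Y => a p.1 p.2) ->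
  ptime (fun x => filter (a x) (l x)).
Proof.
move=> pl pa.
apply: pt_ext (_ : ptime (fun x => rev
   (foldl (fun s y => if a x y then y :: s else s) [::] (l x)))).
  move=> x; have E r : rev (foldl (fun s y => if a x y then y :: s else s)
      r (l x)) = rev r ++ filter (a x) (l x).
    elim: (l x) r => [|y s IH] r /=; first by rewrite cats0.
    by rewrite IH; case: (a x y) => //; rewrite rev_cons cat_rcons.
  exact: E.
apply: pt_rev.
apply: (pt_foldl_add (B := fun p => sz p)
  (st := fun x y s => if a x y then y :: s else s)) => //.
- exact: pt_nil.
- apply: pt_if; last exact: pt_p2.
    exact: (pt_app pa pt_p1).
  by apply: pt_cons; [apply/pt_snd/pt_fst/pt_id | apply: pt_p2].
- exact: pb_sz.
- by move=> x y s; case: ifP; rewrite ?sz_cons ?sz_pair /=; lia.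
Qed.

End MapFilter.

Lemma sz_cat X {eX : Enc X} (s1 s2 : seq X) : (sz (s1 ++ s2)).+1 = sz s1 + sz s2.
Proof. by elim: s1 => [|x s IH] /=; rewrite ?sz_nil ?sz_cons; lia. Qed.

Lemma pt_flatmap X Y Z {eX : Enc X} {eY : Enc Y} {eZ : Enc Z}
    (l : X -> seq Y) (f : X -> Y -> seq Z) :
  ptime l -> ptime (fun p : X * Y => f p.1 p.2) ->
  ptime (fun x => flatten (map (f x) (l x))).
Proof.
move=> pl pf.
apply: pt_ext (_ : ptime (fun x => foldl (fun s y => s ++ f x y) [::] (l x))).
  move=> x; have E r : foldl (fun s y => s ++ f x y) r (l x) =
      r ++ flatten (map (f x) (l x)).
    elim: (l x) r => [|y s IH] r /=; first by rewrite cats0.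
    by rewrite IH catA.
  exact: E.
apply: (pt_foldl_add (B := fun p => sz (f p.1 p.2))
  (st := fun x y s => s ++ f x y)) => //.
- exact: pt_nil.
- by apply: pt_cat; [apply: pt_p2 | exact: (pt_app pf pt_p1)].
- by pb.
- by move=> x y s /=; rewrite -ltnS sz_cat leqnSn.
Qed.

Lemma pt_memn X {eX : Enc X} (l : X -> seq nat) (v : X -> nat) :
  ptime l -> ptime v -> ptime (fun x => v x \in l x).
Proof.
move=> pl pv; apply: pt_ext (_ : ptime (fun x => has (fun y => v x == y) (l x))).
  by move=> x; rewrite -has_pred1; apply: eq_has => y; rewrite /= eq_sym.
apply: (pt_has (a := fun x y => v x == y)) => //.
by apply: pt_eqn; [exact: (pt_app pv pt_p1) | apply: pt_p2].
Qed.

Lemma pt_iota X {eX : Enc X} (f : X -> nat) :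
  ptime f -> ptime (fun x => iota 0 (f x)).
Proof.
move=> pf.
pose (st := fun (_ : X) (_ : unit) (s : nat * seq nat) => (s.1.+1, s.1 :: s.2)).
have stE x k : foldl (fun s y => st x y s) (0, [::]) (nseq k tt) = (k, rev (iota 0 k)).
  elim: k => // k IHk; rewrite -addn1 nseqD foldl_cat IHk /= iotaD /= rev_cat.
  by rewrite addn1.
apply: pt_ext (_ : ptime (fun x => rev
    (foldl (fun s y => st x y s) (0, [::]) (nseq (f x) tt)).2)) => [x|].
  by rewrite stE revK.
apply/pt_rev/pt_snd.
(* A step adds a copy of the counter, so its growth depends on the state and all intermediate states
   have to be bounded explicitly. *)
apply: (pt_foldl (b := fun x => sz (f x) * (sz (f x) + 1) + sz (f x) + 2)).
- exact: pt_iter_list.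
- by apply: pt_pair; [apply: pt_nat0|apply: pt_nil].
- have p2 : ptime (fun p : X * unit * (nat * seq nat) => p.2) by apply: pt_p2.
  by apply: pt_pair; [apply/pt_succ/pt_fst | apply: pt_cons; [apply/pt_fst | apply/pt_snd]].
- by pb.
move=> x k; rewrite size_nseq => le_k.
have -> : take k (nseq (f x) tt) = nseq k tt.
  by elim: k (f x) le_k => [|k IHk] [|m] //= le_k; rewrite IHk.
rewrite stE sz_pair /= !sz_nat.
have le_rev : sz (rev (iota 0 k)) <= k * (k.*2 + 1) + 1.
  elim: k {le_k} => // k IHk; rewrite -addn1 iotaD /= rev_cat /= sz_cons sz_nat.
  nia.
nia.
Qed.

End PolynomialTime.

(** * Running time of the algorithm *)

#[global] Hint Mode Enc - ! : typeclass_instances.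

Ltac pt_proj := repeat first
  [apply: pt_p1 | apply: pt_p2 | apply: pt_id | apply: pt_fst | apply: pt_snd].

Ltac pb := repeat first
  [assumption | apply: pb_const | apply: pb_sz | by apply: pt_size
  | apply: pb_add | apply: pb_mul].

Section AlgorithmTime.
Local Open Scope nat_scope.
Variable R : realType.

Local Notation sz := (@sz R _ _).

#[local] Instance enc_edge : Enc R (edge R) := @enc_pair_inst R _ _ _ _.
#[local] Instance enc_entry : Enc R (entry R) := @enc_pair_inst R _ _ _ _.
#[local] Instance enc_tree : Enc R (tree R) := @enc_pair_inst R _ _ _ _.

Lemma sz_edge (g : edge R) : sz g = sz g.1.1 + sz g.1.2 + 3.
Proof. by rewrite -[sz g]/(((sz g.1.1 + sz g.1.2).+1 + 1).+1); lia. Qed.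

Lemma sz_entry (e : entry R) : sz e = sz e.1.1 + sz e.2 + 3.
Proof. by rewrite -[sz e]/(((sz e.1.1 + 1).+1 + sz e.2).+1); lia. Qed.

Lemma sz_tree (tr : tree R) : sz tr = sz tr.1 + sz tr.2.1 + 3.
Proof. by rewrite -[sz tr]/((sz tr.1 + (sz tr.2.1 + 1).+1).+1); lia. Qed.

Lemma argmin_sub (Y : eqType) (key : Y -> R) (s : seq Y) :
  argmin key s = [::] \/ exists2 y, y \in s & argmin key s = [:: y].
Proof.
have [->|/(argminP key)[y [ys -> _]]] := eqVneq s [::]; first by left.
by right; exists y.
Qed.

Lemma pt_argmin X Y {eX : Enc R X} {eY : Enc R Y} (l : X -> seq Y) (key : Y -> R) :
  ptime l -> ptime key -> ptime (fun x => argmin key (l x)).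
Proof.
move=> pl pkey; apply: (pt_foldl_add (B := fun p => sz p + 5)
  (st := fun _ y m => if has (fun b => (key b <= key y)%R) m then m else [:: y])) => //.
- exact: pt_nil.
- apply: pt_if; [| by pt_proj | by apply: pt_cons; [pt_proj | apply: pt_nil]].
  apply: (pt_has (a := fun p b => (key b <= key p.1.2)%R)); first by pt_proj.
  by apply: pt_ler; apply: (pt_app pkey); pt_proj.
- by pb.
- by move=> x y m; case: ifP => _; rewrite ?sz_pair ?sz_cons ?sz_nil /=; lia.
Qed.

Lemma pt_reached X {eX : Enc R X} (tbl : X -> seq (entry R)) :
  ptime tbl -> ptime (fun x => reached (tbl x)).
Proof. by move=> pt; apply: (pt_map (f := fun _ e => e.1.1)) => //; pt_proj. Qed.

Lemma pt_extensions X {eX : Enc R X} (G : X -> seq (edge R)) (tbl : X -> seq (entry R)) :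
  ptime G -> ptime tbl -> ptime (fun x => extensions (G x) (tbl x)).
Proof.
move=> pG ptbl; apply: (pt_flatmap (f := fun x e =>
  [seq ((g.1.2, e.1.2 + g.2)%R, g :: e.2)
    | g <- [seq g <- G x | (g.1.1 == e.1.1) && (g.1.2 \notin reached (tbl x))]])) => //.
apply: (pt_map (f := fun (p : X * entry R) g => ((g.1.2, p.2.1.2 + g.2)%R, g :: p.2.2))).
  apply: (pt_filter (a := fun (p : X * entry R) g =>
    (g.1.1 == p.2.1.1) && (g.1.2 \notin reached (tbl p.1)))).
    by apply: (pt_app pG); pt_proj.
  apply: pt_and; first by apply: pt_eqn; pt_proj.
  apply/pt_neg/pt_memn; last by pt_proj.
  by apply: pt_reached; apply: (pt_app ptbl); pt_proj.
apply: pt_pair; first by apply: pt_pair; [pt_proj | apply: pt_addr; pt_proj].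
by apply: pt_cons; pt_proj.
Qed.

Lemma pt_dijkstra_step X {eX : Enc R X} (G : X -> seq (edge R)) (tbl : X -> seq (entry R)) :
  ptime G -> ptime tbl -> ptime (fun x => dijkstra_step (G x) (tbl x)).
Proof.
move=> pG ptbl; apply: pt_cat => //; apply: pt_argmin; first exact: pt_extensions.
by pt_proj.
Qed.

Lemma sz_mem (Y : eqType) {eY : Enc R Y} (s : seq Y) y : y \in s -> sz y < sz s.
Proof.
elim: s => // y' s IHs; rewrite inE sz_cons => /predU1P[->|/IHs]; lia.
Qed.

Lemma sz_le (Y : eqType) {eY : Enc R Y} (s : seq Y) b :
  (forall y, y \in s -> sz y <= b) -> sz s <= size s * b.+1 + 1.
Proof.
elim: s => [|y s IHs] le_b; first by rewrite sz_nil.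
rewrite sz_cons /= mulSn; have := le_b y (mem_head _ _).
by have := IHs (fun z zs => le_b z (mem_behead (s := y :: s) zs)); lia.
Qed.

Lemma size_sz Y {eY : Enc R Y} (s : seq Y) : size s < sz s.
Proof. by elim: s => //= y s; rewrite sz_cons; lia. Qed.

Lemma sz_mem_edge (G : seq (edge R)) (a b : nat) (x : R) : ((a, b), x) \in G ->
  sz b <= sz G /\ sz (((a, b), x) : edge R) < sz G.
Proof.
move=> gG; have lt_g : sz (((a, b), x) : edge R) < sz G by apply: sz_mem.
by split=> //; rewrite sz_edge /= in lt_g; lia.
Qed.

(** A round of [dijkstra] copies a path out of the table, so its growth is not additive. Instead,
    after [k] rounds each path has at most [k] edges, all taken from [G]. *)
Definition small_entry (G : seq (edge R)) (VT : seq nat) k (e : entry R) : Prop :=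
  sz e.1.1 <= sz VT + sz G /\ sz e.2 <= k * sz G + 1.

Lemma small_extension (G : seq (edge R)) (VT : seq nat) k (e e' : entry R) (x : R) :
  small_entry G VT k e' -> ((e'.1.1, e.1.1), x) \in G ->
  e.2 = ((e'.1.1, e.1.1), x) :: e'.2 -> small_entry G VT k.+1 e.
Proof.
case: e e' => [[v d] es] [[v' d'] es'] [/= _ le_es'] Gx ->.
have [le_v le_x] := sz_mem_edge Gx.
split=> /=; first exact: leq_trans le_v (leq_addl _ _).
by rewrite sz_cons mulSn; lia.
Qed.

Lemma dijkstra_step_small (G : seq (edge R)) (VT : seq nat) k
    (tbl : seq (entry R)) :
  size tbl <= size VT + k ->
  (forall e, e \in tbl -> small_entry G VT k e) ->
  size (dijkstra_step G tbl) <= size VT + k.+1 /\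
  forall e, e \in dijkstra_step G tbl -> small_entry G VT k.+1 e.
Proof.
move=> le_size small; rewrite /dijkstra_step.
have small' e : e \in tbl -> small_entry G VT k.+1 e.
  by move=> /small[le1 le2]; split=> //; rewrite mulSn; lia.
have [->|[e /mem_extensions[e' [x [e'_in Gx _ def_e]]] ->]] :=
  argmin_sub (fun e : entry R => e.1.2) (extensions G tbl).
  by split=> /=; [lia | exact: small'].
split=> /= [|f]; first by lia.
rewrite inE => /predU1P[->|]; last exact: small'.
by apply: small_extension (small _ e'_in) Gx _; rewrite {1}def_e.
Qed.

Lemma dijkstra_small (G : seq (edge R)) (VT s : seq nat)
    (tbl := foldl (fun tbl _ => dijkstra_step G tbl) [seq ((v, 0%R), [::]) | v <- VT] s) :
  size tbl <= size VT + size s /\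
  forall e, e \in tbl -> small_entry G VT (size s) e.
Proof.
rewrite /tbl {tbl}; elim/last_ind: s => [|s v [le_size small]].
  rewrite /= size_map addn0; split=> // e /mapP[v vVT ->].
  by split=> //=; apply: leq_trans (ltnW (sz_mem vVT)) (leq_addr _ _).
by rewrite foldl_rcons size_rcons; apply: dijkstra_step_small.
Qed.

Lemma pt_dijkstra X {eX : Enc R X} (G : X -> seq (edge R)) (V VT : X -> seq nat) :
  ptime G -> ptime V -> ptime VT -> ptime (fun x => dijkstra (G x) (V x) (VT x)).
Proof.
move=> pG pV pVT.
apply: (pt_foldl (st := fun x _ tbl => dijkstra_step (G x) tbl)
  (b := fun x => (sz (VT x) + sz (V x)) *
     (sz (VT x) + sz (G x) + (sz (V x) * sz (G x) + 1) + 4) + 1)) => //.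
- apply: (pt_map (f := fun _ v => ((v, 0%R), [::]))) => //.
  by do !apply: pt_pair; [pt_proj | apply: pt_zero | apply: pt_nil].
- by apply: pt_dijkstra_step; [apply: (pt_app pG); pt_proj | pt_proj].
- by pb.
move=> x k le_k.
have [le_size small] := dijkstra_small (G x) (VT x) (take k (V x)).
apply: leq_trans (sz_le (b := sz (VT x) + sz (G x) + (sz (V x) * sz (G x) + 1) + 3) _) _.
  move=> e /small[le1 le2]; rewrite sz_entry.
  have : size (take k (V x)) * sz (G x) <= sz (V x) * sz (G x).
    by rewrite leq_mul2r size_takel ?(leq_trans le_k) ?orbT // ltnW // size_sz.
  by lia.
rewrite -addnS leq_add2r leq_mul2r; apply/orP; right.
have lt_VT : size (VT x) < sz (VT x) by apply: size_sz.
have lt_V : size (V x) < sz (V x) by apply: size_sz.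
by apply: leq_trans le_size _; rewrite size_takel //; lia.
Qed.

Lemma pt_add_edge X {eX : Enc R X} (tr : X -> tree R) (g : X -> edge R) :
  ptime tr -> ptime g -> ptime (fun x => add_edge (tr x) (g x)).
Proof.
move=> ptr pg; have ptr1 := pt_fst ptr; have ptr2 := pt_snd ptr.
apply: pt_if => //; first by apply: pt_memn => //; apply: pt_snd; apply: pt_fst.
apply: pt_pair; first by apply: pt_cons => //; apply: pt_snd; apply: pt_fst.
apply: pt_pair; first by apply: pt_cons => //; apply: pt_fst.
by apply: pt_addr; apply: pt_snd.
Qed.

Lemma sz_add_edge tr (g : edge R) : sz (add_edge tr g) <= sz tr + 2 * (sz g + 1).
Proof.
rewrite /add_edge; case: ifP => _; first by lia.
by rewrite !sz_tree /= !sz_cons !sz_edge; lia.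
Qed.

Lemma sz_rev Y {eY : Enc R Y} (s : seq Y) : sz (rev s) = sz s.
Proof.
elim: s => // y s IHs; rewrite rev_cons -cats1 sz_cons; apply: succn_inj.
by rewrite sz_cat sz_cons IHs sz_nil; lia.
Qed.

Lemma sz_add_walk tr (es : seq (edge R)) : sz (add_walk tr es) <= sz tr + 2 * sz es.
Proof.
rewrite /add_walk -(sz_rev es); elim: (rev es) tr => [|g s IHs] tr /=.
  by lia.
by apply: leq_trans (IHs _) _; have := sz_add_edge tr g; rewrite sz_cons; lia.
Qed.

Lemma pt_add_walk X {eX : Enc R X} (tr : X -> tree R) (es : X -> seq (edge R)) :
  ptime tr -> ptime es -> ptime (fun x => add_walk (tr x) (es x)).
Proof.
move=> ptr pes; apply: (pt_foldl_add (B := fun p => 2 * (sz p + 1))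
  (st := fun _ g tr => add_edge tr g)) => //.
- exact: pt_rev.
- by apply: pt_add_edge; pt_proj.
- by pb.
by move=> x g t; apply: leq_trans (sz_add_edge t g) _; rewrite sz_pair /=; lia.
Qed.

Lemma pt_join_step X {eX : Enc R X} (G : X -> seq (edge R)) (V Z : X -> seq nat)
    (tr : X -> tree R) :
  ptime G -> ptime V -> ptime Z -> ptime tr ->
  ptime (fun x => join_step (G x) (V x) (Z x) (tr x)).
Proof.
move=> pG pV pZ ptr; apply: (pt_foldl_add (B := fun p => 2 * sz p)
  (st := fun _ (e : entry R) tr => add_walk tr e.2)) => //.
- apply: pt_argmin; last by pt_proj.
  apply: (pt_filter (a := fun x e => (e.1.1 \in Z x) && (e.1.1 \notin (tr x).1))).
    by apply: pt_dijkstra => //; apply: pt_fst.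
  apply: pt_and; first by apply: pt_memn; [apply: (pt_app pZ)|]; pt_proj.
  by apply/pt_neg/pt_memn; [apply: pt_fst; apply: (pt_app ptr)|]; pt_proj.
- by apply: pt_add_walk; pt_proj.
- by pb.
move=> x e t; apply: leq_trans (sz_add_walk t e.2) _.
by rewrite sz_pair sz_entry /=; lia.
Qed.

(** The path that is added has at most [size V] edges. The resulting increment is independent of
    [tr], as [pt_foldl_add] demands for the loop of [join_tree]. *)
Lemma sz_join_step G V Z tr :
  sz (join_step G V Z tr) <= sz tr + 2 * (sz V * sz G + 1).
Proof.
rewrite /join_step.
have [->|[e]] := argmin_sub (fun e : entry R => e.1.2)
    [seq e <- dijkstra G V tr.1 | (e.1.1 \in Z) && (e.1.1 \notin tr.1)].
  by rewrite /=; lia.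
rewrite mem_filter => /andP[_ /(dijkstra_small G tr.1 V).2[_ le_e]] -> /=.
apply: leq_trans (sz_add_walk _ _) _; rewrite leq_add2l leq_mul2l /=.
apply: leq_trans le_e _; rewrite leq_add2r leq_mul2r; apply/orP; right.
by apply: ltnW; apply: size_sz.
Qed.

Lemma pt_last X Y {eX : Enc R X} {eY : Enc R Y} (d : X -> Y) (l : X -> seq Y) :
  ptime d -> ptime l -> ptime (fun x => last (d x) (l x)).
Proof.
move=> pd pl; apply: pt_ext (_ : ptime (fun x => foldl (fun _ y => y) (d x) (l x))).
  by move=> x; elim: (l x) (d x) => //= y s ->.
apply: (pt_foldl_add (B := fun p => sz p) (st := fun _ y _ => y)) => //.
- by pt_proj.
- by pb.
by move=> x y s; rewrite sz_pair /=; lia.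
Qed.

Lemma pt_join_tree X {eX : Enc R X} (G : X -> seq (edge R)) (V Z : X -> seq nat) :
  ptime G -> ptime V -> ptime Z -> ptime (fun x => join_tree (G x) (V x) (Z x)).
Proof.
move=> pG pV pZ; apply: (pt_foldl_add
  (B := fun p => 2 * (sz (V p.1) * sz (G p.1) + 1))
  (st := fun x _ tr => join_step (G x) (V x) (Z x) tr)) => //.
- apply: pt_pair; last by apply: pt_pair; [apply: pt_nil | apply: pt_zero].
  apply: pt_cons; last exact: pt_nil.
  by apply: (pt_last (d := fun=> 0)) => //; apply: pt_nat0.
- by apply: pt_join_step; [apply: (pt_app pG)|apply: (pt_app pV)|apply: (pt_app pZ)|];
    pt_proj.
- have pV1 : ptime (fun p : X * nat => V p.1) by apply: (pt_app pV); pt_proj.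
  have pG1 : ptime (fun p : X * nat => G p.1) by apply: (pt_app pG); pt_proj.
  by apply: pb_mul; [apply: pb_const | pb].
by move=> x y t; apply: sz_join_step.
Qed.

Lemma pt_branching X {eX : Enc R X} (Q : X -> seq nat) (es : X -> seq (edge R)) :
  ptime Q -> ptime es -> ptime (fun x => branching (Q x) (es x)).
Proof.
move=> pQ pes; apply: pt_snd.
apply: (pt_foldl_add (B := fun p => sz p) (st := fun _ g s => branching_step s g)) => //.
- by apply: pt_pair => //; apply: pt_nil.
- apply: pt_if; last by pt_proj.
    by apply: pt_memn; pt_proj.
  apply: pt_if; first by apply: pt_memn; pt_proj.
    by apply: pt_pair; [pt_proj | apply: pt_cons; pt_proj].
  by apply: pt_pair; [apply: pt_cons; pt_proj | pt_proj].
- by pb.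
move=> x [[a b] w] [al L]; rewrite /branching_step.
by do 2?case: ifP => _; rewrite !sz_pair ?sz_edge /= ?sz_cons; lia.
Qed.

Lemma pt_lists X {eX : Enc R X} m (V : X -> seq nat) :
  ptime V -> ptime (fun x => lists m (V x)).
Proof.
move=> pV; elim: m => [|m IHm] /=.
  by apply: pt_cons; apply: pt_nil.
apply: pt_cons; first exact: pt_nil.
apply: (pt_flatmap (f := fun x v => [seq v :: s | s <- lists m (V x)])) => //.
apply: (pt_map (f := fun (p : X * nat) s => p.2 :: s)).
  by apply: (pt_app IHm); pt_proj.
by apply: pt_cons; pt_proj.
Qed.

Lemma pt_swap X {eX : Enc R X} (V Q L D : X -> seq nat) :
  ptime V -> ptime Q -> ptime L -> ptime D ->
  ptime (fun x => swap (V x) (Q x) (L x) (D x)).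
Proof.
move=> pV pQ pL pD; apply: (pt_filter
  (a := fun x v => (v \in Q x) || ((v \in L x) (+) (v \in D x)))) => //.
apply: pt_or; first by apply: pt_memn; [apply: (pt_app pQ)|]; pt_proj.
by apply: pt_xor; apply: pt_memn; try (by pt_proj);
  [apply: (pt_app pL)|apply: (pt_app pD)]; pt_proj.
Qed.

Lemma pt_sym_edges X {eX : Enc R X} (G : X -> seq (edge R)) :
  ptime G -> ptime (fun x => sym_edges (G x)).
Proof.
move=> pG; apply: pt_cat => //.
apply: (pt_map (f := fun _ g => ((g.1.2, g.1.1), g.2))) => //.
by do ?apply: pt_pair; pt_proj.
Qed.

Lemma pt_candidates X {eX : Enc R X} m (n : X -> nat) (G : X -> seq (edge R))
    (T VO Q : X -> seq nat) :
  ptime n -> ptime G -> ptime T -> ptime VO -> ptime Q ->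
  ptime (fun x => candidates m (n x) (G x) (T x) (VO x) (Q x)).
Proof.
move=> pn pG pT pVO pQ; have pV := pt_iota pn.
have pL : ptime (fun x => branching (Q x)
    (join_tree (G x) (iota 0 (n x)) (VO x ++ [seq v <- T x | v \notin Q x])).2.1).
  apply: pt_branching => //; apply: pt_fst; apply: pt_snd; apply: pt_join_tree => //.
  apply: pt_cat => //; apply: (pt_filter (a := fun x v => v \notin Q x)) => //.
  by apply/pt_neg/pt_memn; [apply: (pt_app pQ)|]; pt_proj.
apply: (pt_map (f := fun x D => join_tree (G x) (iota 0 (n x))
  (swap (iota 0 (n x)) (Q x) (branching (Q x)
    (join_tree (G x) (iota 0 (n x)) (VO x ++ [seq v <- T x | v \notin Q x])).2.1) D))).
  exact: pt_lists.
apply: pt_join_tree; [apply: (pt_app pG)|apply: (pt_app pV)|]; try by pt_proj.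
by apply: pt_swap; [apply: (pt_app pV)|apply: (pt_app pQ)|apply: (pt_app pL)|]; pt_proj.
Qed.

Lemma pt_best X {eX : Enc R X} (ts : X -> seq (tree R)) :
  ptime ts -> ptime (fun x => best (ts x)).
Proof.
move=> pts; apply: (pt_last (d := fun=> ([::], ([::], 0%R))));
  last by apply: pt_argmin => //; pt_proj.
by do ?apply: pt_pair; [apply: pt_nil|apply: pt_nil|apply: pt_zero].
Qed.

Lemma pt_has_edge X {eX : Enc R X} (es : X -> seq (edge R)) (a b : X -> nat) :
  ptime es -> ptime a -> ptime b -> ptime (fun x => has_edge (es x) (a x) (b x)).
Proof.
move=> pes pa pb; apply: (pt_has (a := fun x h =>
  (h.1.1 == a x) && (h.1.2 == b x) || (h.1.1 == b x) && (h.1.2 == a x))) => //.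
have pa' : ptime (fun p : X * edge R => a p.1) by apply: (pt_app pa); pt_proj.
have pb' : ptime (fun p : X * edge R => b p.1) by apply: (pt_app pb); pt_proj.
by apply: pt_or; apply: pt_and; apply: pt_eqn => //; pt_proj.
Qed.

Lemma pt_reopt m : ptime (@reopt R m).
Proof.
pose n (d : reopt_data R) := d.1.1; pose G (d : reopt_data R) := d.1.2.1.
pose T (d : reopt_data R) := d.1.2.2.1; pose VO (d : reopt_data R) := d.2.1.1.
pose Q (d : reopt_data R) := d.2.2.1.2.2.1.
pose tr d := best (candidates m (n d) (sym_edges (G d)) (T d) (VO d) (Q d)).
apply: pt_ext (_ : ptime (fun d => ([seq v <- iota 0 (n d) | v \in (tr d).1],
   ([seq g.1 | g <- [seq g <- G d | has_edge (tr d).2.1 g.1.1 g.1.2]], tt)))).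
  by case=> -[n0 [G0 [T0 u1]]] [[VO0 u2] [[n1 [G1 [Q1 u3]]] u4]].
have [pn pG pT] : [/\ ptime n, ptime G & ptime T] by split; pt_proj.
have [pVO pQ] : ptime VO /\ ptime Q by split; pt_proj.
have ptr : ptime tr by apply/pt_best/pt_candidates => //; apply: pt_sym_edges.
apply: pt_pair.
  apply: (pt_filter (a := fun d v => v \in (tr d).1)); first exact: pt_iota.
  by apply: pt_memn; [apply: pt_fst; apply: (pt_app ptr)|]; pt_proj.
apply: pt_pair; last exact: pt_unit.
apply: (pt_map (f := fun _ g => g.1)); last by pt_proj.
apply: (pt_filter (a := fun d g => has_edge (tr d).2.1 g.1.1 g.1.2)) => //.
by apply: pt_has_edge; [apply: pt_fst; apply: pt_snd; apply: (pt_app ptr)| |]; pt_proj.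
Qed.

End AlgorithmTime.

(** * Agreement with the prescribed encodings, and conclusion *)

Lemma enc_vertices_eq (R : realType) n (U : {set 'I_n}) :
  enc_vertices R U = enc (vertices U).
Proof. by rewrite /enc_vertices /enc /enc_seq_inst /vertices -map_comp. Qed.

Lemma enc_subgraphE (R : realType) n (S : subgraph n) :
  enc_subgraph R S = enc (subgraph_output S).
Proof.
rewrite /enc_subgraph enc_vertices_eq /enc_edges.
rewrite -[RHS]/(DCons (enc (vertices (sverts S))) (DCons (enc (subgraph_output S).2.1) DNil)).
by rewrite [enc (subgraph_output S).2.1]/enc /enc_seq_inst /= -map_comp.
Qed.

Lemma enc_stpE (R : realType) n (I : stp R n) : enc_stp I = enc (stp_input I).
Proof.
rewrite /enc_stp enc_vertices_eq /enc_weighted_edges.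
rewrite -[RHS]/(DCons (enc n) (DCons (enc (stp_input I).2.1)
  (DCons (enc (vertices (stp_terminals I))) DNil))).
by rewrite [enc (stp_input I).2.1]/enc /enc_seq_inst /= /weighted_edges -map_comp.
Qed.

Lemma enc_reoptE (R : realType) n (I : stp R n) OPT I' :
  enc_reopt I OPT I' = enc (reopt_input I OPT I').
Proof. by rewrite /enc_reopt !enc_stpE enc_subgraphE. Qed.

Theorem theorem9 (R : realType) (eps : R) (heps : 0 < eps) :
  exists (A : program) (q : {poly nat}),
    forall (n : nat) (E : {set {set 'I_n}}) (c : {set 'I_n} -> R)
      (T : {set 'I_n}) (t : 'I_n) (OPT : subgraph n),
      let I := STP E c T in
      let I' := STP E c (T :\ t) in
      let input := enc_reopt I OPT I' in
      stp_instance I -> optimal I OPT -> t \in T ->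
      exists (S : subgraph n) (k : nat),
        [/\ runs_in A input (enc_subgraph R S) k,
            (k <= q.[data_size input])%N
          & approximate eps I' S].
Proof.
have [m correct] := reopt_correct heps.
have [P [time [[C [D le_time]] _ run]]] := pt_reopt R m.
(* The code is placed at index 0, so that its first function is the main one. *)
exists (P 0%N), (C *: 'X^D) => n E c T t OPT I I' input inst opt tT.
have [S [out apx]] := correct n E c T t OPT inst opt tT.
have [//|k le_k ev] := run 0%N (P 0%N) _ (reopt_input I OPT I').
exists S, k; split=> //.
  by rewrite /runs_in /input enc_reoptE enc_subgraphE -out.
apply: leq_trans le_k _; apply: leq_trans (le_time _) _.
by rewrite hornerZ hornerXn /input enc_reoptE.
Qed.
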